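(* Let $\alpha\in\{1,2,3\}$ and let $S\in\mathcal C^1_{\mathrm{per},1,2,3}$ be a real-valued shape function. For the pseudo-differential DFT operators $\Pi^\ell$ defined in the context, the exact solution $\varphi_{\tau,v_\alpha}:\mathsf U^0\mapsto\mathsf U(\tau)$, $\tau\neq0$, of the kinetic split step in direction $\alpha$ (the ODE system given in the context, with initial data marked by a superscript $0$) is given explicitly, for all $p\in\{1,\dots,N\}$, $\boldsymbol k\in\{-K,\dots,K\}^3$ and $\nu=\pm1$, by $$\begin{aligned} X_{p,\alpha}(\tau)&=X^0_{p,\alpha}+\tau V_{p,\alpha},\qquad X_{p,\alpha+\nu}(\tau)=X^0_{p,\alpha+\nu},\qquad V_{p,\alpha}(\tau)=V^0_{p,\alpha},\\ V_{p,\alpha+\nu}(\tau)&=V^0_{p,\alpha+\nu}-\nu\tau\frac{q_p}{m_p}L^3\sum_{\boldsymbol k\in\{-K,\dots,K\}^3}B_{\alpha-\nu,\boldsymbol k}\,\overline{\hat V^{2,\nu}_{p,\alpha,\boldsymbol k}(\tau)},\\ E_{\alpha,\boldsymbol k}(\tau)&=E^0_{\alpha,\boldsymbol k}-\tau\sum_{p=1}^Nq_p\hat V^3_{p,\alpha,\boldsymbol k}(\tau),\qquad E_{\alpha+\nu,\boldsymbol k}(\tau)=E^0_{\alpha+\nu,\boldsymbol k},\qquad\boldsymbol B_{\boldsymbol k}(\tau)=\boldsymbol B^0_{\boldsymbol k}, \end{aligned}$$ with $$\hat V^{2,\nu}_{p,\alpha,\boldsymbol k}(\tau)=\begin{cases}V_{p,\alpha}(\Pi^2_{\alpha+\nu}S_{\boldsymbol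 X^0_p})_{\boldsymbol k}&\text{if }k_\alpha=0,\\[4pt]-\Big(\dfrac{2i\pi k_\alpha}L\Big)^{-1}\dfrac1\tau\Big[(\Pi^2_{\alpha+\nu}S_{\boldsymbol X_p})_{\boldsymbol k}\Big]_0^\tau&\text{if }k_\alpha\neq0,\end{cases}$$ $$\hat V^{3}_{p,\alpha,\boldsymbol k}(\tau)=\begin{cases}V_{p,\alpha}(\Pi^3S_{\boldsymbol X^0_p})_{\boldsymbol k}&\text{if }k_\alpha=0,\\[4pt]-\Big(\dfrac{2i\pi k_\alpha}L\Big)^{-1}\dfrac1\tau\Big[(\Pi^3S_{\boldsymbol X_p})_{\boldsymbol k}\Big]_0^\tau&\text{if }k_\alpha\neq0,\end{cases}$$ where $[g(\boldsymbol X_p)]_0^\tau=g(\boldsymbol X_p(\tau))-g(\boldsymbol X_p^0)$.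
   Context: Fix $L>0$, integers $K\ge0$, $M\ge2K+1$, $N\ge1$, charges $q_p\in\mathbb R$, masses $m_p>0$; $h=L/M$. Dimension indices are circular: $\alpha\equiv\alpha+3$. Let $\gamma_{\boldsymbol k}=\overline{\gamma_{-\boldsymbol k}}\in\mathbb C$ be Hermitian filter coefficients. Function space. $\mathcal C^0_{\mathrm{per}}$ is the space of continuous functions on $\mathbb R^3$, $L$-periodic in each variable; $\mathcal C^1_{\mathrm{per},1,2,3}$ is the space of $G\in\mathcal C^0_{\mathrm{per}}$ all of whose mixed derivatives of order at most one in each variable (up to $\partial_1\partial_2\partial_3G$) belong to $\mathcal C^0_{\mathrm{per}}$. Write $S_{\boldsymbol y}(\boldsymbol x)=S(\boldsymbol x-\boldsymbol y)$. Conservative DFT. $\tilde{\mathcal F}_{M,\boldsymbol k}=\tilde{\mathcal F}_{M,k_1}\otimes\tilde{\mathcal F}_{M,k_2}\otimes\tilde{\mathcal F}_{M,k_3}$ is the functional on $\mathcal C^0_{\mathrm{per}}$ obtained by applying in each variable the univariate functional $$\tilde{\mathcal F}_{M,k_\alpha}(g)=\begin{cases}\frac1L\int_0^Lg(x)\,dx&\text{if }k_\alpha=0,\\ \frac1M\sum_{m=1}^Mg(mh)\,e^{-2i\pi k_\alpha m/M}&\text{if }k_\alpha\ne0.\end{cases}$$ For $c\in\mathbb C$ and a function $G$: $\hat D_{\boldsymbol k,\alpha}c=c$, $\tilde D_{\boldsymbol k,\alpha}G=G$ if $k_\alpha=0$; $\hat D_{\boldsymbol k,\alpha}c=\frac{2i\pi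 k_\alpha}Lc$, $\tilde D_{\boldsymbol k,\alpha}G=\partial_\alpha G$ if $k_\alpha\neq0$. Coupling operators (Fourier coefficients for $\boldsymbol k\in\{-K,\dots,K\}^3$): $$(\Pi^3G)_{\boldsymbol k}=\gamma_{\boldsymbol k}\tilde{\mathcal F}_{M,\boldsymbol k}(G),\qquad(\Pi^2_\alpha G)_{\boldsymbol k}=\gamma_{\boldsymbol k}(\hat D_{\boldsymbol k,\alpha})^{-1}\tilde{\mathcal F}_{M,\boldsymbol k}(\tilde D_{\boldsymbol k,\alpha}G),$$ $$(\Pi^1_\alpha G)_{\boldsymbol k}=\gamma_{\boldsymbol k}(\hat D_{\boldsymbol k,\alpha+1}\hat D_{\boldsymbol k,\alpha+2})^{-1}\tilde{\mathcal F}_{M,\boldsymbol k}(\tilde D_{\boldsymbol k,\alpha+1}\tilde D_{\boldsymbol k,\alpha+2}G).$$ The state $\mathsf U$ consists of particle positions $\boldsymbol X_p=(X_{p,\alpha})_\alpha\in\mathbb R^3$, velocities $\boldsymbol V_p=(V_{p,\alpha})_\alpha\in\mathbb R^3$, and the Fourier coefficients $\boldsymbol E_{\boldsymbol k}=(E_{\alpha,\boldsymbol k})_\alpha$, $\boldsymbol B_{\boldsymbol k}=(B_{\alpha,\boldsymbol k})_\alpha\in\mathbb C^3$, $\boldsymbol k\in\{-K,\dots,K\}^3$, of real-valued fields (Hermitian coefficients). The kinetic split step in direction $\alpha$ is the ODE system, for all $p$, $\boldsymbol k$ and $\nu=\pm1$, $$\begin{aligned} &\tfrac d{dt}X_{p,\alpha}=V_{p,\alpha},\quad\tfrac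 d{dt}X_{p,\alpha+\nu}=0,\quad\tfrac d{dt}V_{p,\alpha}=0,\\ &\tfrac d{dt}V_{p,\alpha+\nu}=-\nu\frac{q_p}{m_p}L^3\sum_{\boldsymbol k}V_{p,\alpha}B_{\alpha-\nu,\boldsymbol k}\overline{(\Pi^1_{\alpha-\nu}S_{\boldsymbol X_p})_{\boldsymbol k}},\\ &\tfrac d{dt}E_{\alpha,\boldsymbol k}=-\sum_pq_pV_{p,\alpha}(\Pi^2_\alpha S_{\boldsymbol X_p})_{\boldsymbol k},\quad\tfrac d{dt}E_{\alpha+\nu,\boldsymbol k}=0,\quad\tfrac d{dt}\boldsymbol B_{\boldsymbol k}=0. \end{aligned}$$ In the claim, $V_{p,\alpha}$ and $B_{\alpha-\nu,\boldsymbol k}$ without time argument denote the (constant) values $V_{p,\alpha}^0$ and $B_{\alpha-\nu,\boldsymbol k}^0$. *)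

(* Defs.v *)
(* Stdlib world: the real numbers R with Coquelicot's C, derivatives and
   integrals; MathComp supplies only finite index types and big operators. *)
From mathcomp Require Import all_boot.
From Stdlib Require Import Reals ZArith.
From Coquelicot Require Import Coquelicot.
Set Implicit Arguments.
Unset Strict Implicit.
Unset Printing Implicit Defensive.
Open Scope R_scope.

(* The dimensions 1, 2, 3 are 0, 1, 2 : 'I_3.  [cyc a z] is the circular index
   a + z, reduced modulo 3. *)
Definition cyc (a : 'I_3) (z : Z) : 'I_3 :=
  inord (Z.to_nat ((Z.of_nat a + z) mod 3)).

(* The topology on points is that of Coquelicot's [fct_UniformSpace], i.e. of
   the sup-norm. *)
Definition point := 'I_3 -> R.

Definition upd (x : point) (a : 'I_3) (t : R) : point :=
  fun b => if b == a then t else x b.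

Definition point3 (x y z : R) : point := fun a => nth 0 [:: x; y; z] a.

Definition translate (y : point) (G : point -> C) : point -> C :=
  fun x => G (fun a => x a - y a).

Definition C0per (L : R) (G : point -> C) : Prop :=
  (forall x : point, continuous G x) /\
  (forall (a : 'I_3) (x : point), G (upd x a (x a + L)) = G x).

(* Total partial derivative, meaningful where the derivative exists. *)
Definition pderiv (a : 'I_3) (G : point -> C) : point -> C := fun x =>
  (Derive (fun t => Re (G (upd x a t))) (x a),
   Derive (fun t => Im (G (upd x a t))) (x a)).

Definition mixed (s : seq 'I_3) (G : point -> C) : point -> C :=
  foldr pderiv G s.

(* A duplicate-free s lists the variables of a mixed derivative of order at
   most one in each variable, in an arbitrary order of differentiation.  The
   second conjunct says that each such derivative really exists. *)
Definition C1per (L : R) (G : point -> C) : Prop :=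
  forall s : seq 'I_3, uniq s ->
    C0per L (mixed s G) /\
    (forall (a : 'I_3) (x : point), a \notin s ->
       is_derive (V := C_R_NormedModule)
         (fun t : R => mixed s G (upd x a t)) (x a) (pderiv a (mixed s G) x)).

(* The multi-indices {-K,...,K}^3: [kval k a] is the component of k in
   direction a, and [rev_ord] realizes the change of sign. *)
Definition mode (K : nat) := {ffun 'I_3 -> 'I_(2 * K).+1}.

Definition kval (K : nat) (k : mode K) (a : 'I_3) : Z :=
  (Z.of_nat (k a) - Z.of_nat K)%Z.

Definition mode_opp (K : nat) (k : mode K) : mode K :=
  [ffun a => rev_ord (k a)].

Definition hermitian (K : nat) (c : mode K -> C) : Prop :=
  forall k, c k = Cconj (c (mode_opp k)).

Definition cis (theta : R) : C := (cos theta, sin theta).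

Definition dft1 (L : R) (M : nat) (k : Z) (g : R -> C) : C :=
  if Z.eqb k 0 then
    (RtoC (/ L) * RInt (V := C_R_CompleteNormedModule) g 0 L)%C
  else
    (RtoC (/ INR M) *
     \big[Cplus/RtoC 0]_(1 <= j < M.+1)
       (g (INR j * (L / INR M))%R * cis (- (2 * PI * IZR k * INR j / INR M))))%C.

Definition dft (L : R) (M K : nat) (k : mode K) (G : point -> C) : C :=
  dft1 L M (kval k (inord 0)) (fun x1 =>
  dft1 L M (kval k (inord 1)) (fun x2 =>
  dft1 L M (kval k (inord 2)) (fun x3 => G (point3 x1 x2 x3)))).

Definition fourier_symbol (L : R) (k : Z) : C :=
  (RtoC 2 * Ci * RtoC PI * RtoC (IZR k) / RtoC L)%C.

(* The operator c |-> \hat D_{k,a} c is multiplication by this number, hence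
   its inverse is multiplication by the reciprocal. *)
Definition Dhat (L : R) (K : nat) (k : mode K) (a : 'I_3) : C :=
  if Z.eqb (kval k a) 0 then RtoC 1 else fourier_symbol L (kval k a).

Definition Dtilde (K : nat) (k : mode K) (a : 'I_3) (G : point -> C) :
    point -> C :=
  if Z.eqb (kval k a) 0 then G else pderiv a G.

Definition Pi3 (L : R) (M K : nat) (gam : mode K -> C) (G : point -> C)
    (k : mode K) : C :=
  (gam k * dft L M k G)%C.

Definition Pi2 (L : R) (M K : nat) (gam : mode K -> C) (a : 'I_3)
    (G : point -> C) (k : mode K) : C :=
  (gam k * / Dhat L k a * dft L M k (Dtilde k a G))%C.

Definition Pi1 (L : R) (M K : nat) (gam : mode K -> C) (a : 'I_3)
    (G : point -> C) (k : mode K) : C :=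
  (gam k * / (Dhat L k (cyc a 1) * Dhat L k (cyc a 2)) *
   dft L M k (Dtilde k (cyc a 1) (Dtilde k (cyc a 2) G)))%C.

Record state (N K : nat) := State {
  X : 'I_N -> point;
  V : 'I_N -> point;
  E : 'I_3 -> mode K -> C;
  B : 'I_3 -> mode K -> C;
  E_hermitian : forall a, hermitian (E a);
  B_hermitian : forall a, hermitian (B a)
}.

(* U solves the kinetic split step in direction a on the open time interval
   ]t0, t1[.  The equation for the real velocity V_{a+nu} is an equality in C,
   because its right-hand side is written as a complex sum. *)
Definition kinetic_solution (L : R) (M N K : nat) (q m : 'I_N -> R)
    (gam : mode K -> C) (shape : point -> C) (a : 'I_3)
    (t0 t1 : Rbar) (U : R -> state N K) : Prop :=
  forall t : R, Rbar_lt t0 t -> Rbar_lt t t1 ->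
  (forall p : 'I_N,
     is_derive (fun s : R => X (U s) p a) t (V (U t) p a) /\
     is_derive (fun s : R => V (U s) p a) t 0) /\
  (forall k : mode K,
     is_derive (V := C_R_NormedModule) (fun s : R => E (U s) a k) t
       (- \big[Cplus/RtoC 0]_(p < N)
            (RtoC (q p) * RtoC (V (U t) p a) *
             Pi2 L M gam a (translate (X (U t) p) shape) k))%C) /\
  (forall nu : Z, nu = 1%Z \/ nu = (-1)%Z ->
     (forall p : 'I_N,
        is_derive (fun s : R => X (U s) p (cyc a nu)) t 0 /\
        is_derive (V := C_R_NormedModule)
          (fun s : R => RtoC (V (U s) p (cyc a nu))) t
          (RtoC (- IZR nu * (q p / m p) * L ^ 3) *
           \big[Cplus/RtoC 0]_(k : mode K)
             (RtoC (V (U t) p a) * B (U t) (cyc a (- nu)) k *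
              Cconj (Pi1 L M gam (cyc a (- nu))
                       (translate (X (U t) p) shape) k)))%C) /\
     (forall k : mode K,
        is_derive (V := C_R_NormedModule)
          (fun s : R => E (U s) (cyc a nu) k) t (RtoC 0))) /\
  (forall (b : 'I_3) (k : mode K),
     is_derive (V := C_R_NormedModule) (fun s : R => B (U s) b k) t (RtoC 0)).

(* In [Vhat2] and [Vhat3], v is the velocity V_{p,a}, x0 the initial position
   X_p^0 and x1 the position X_p(tau). *)
Definition Vhat2 (L : R) (M K : nat) (gam : mode K -> C) (shape : point -> C)
    (a : 'I_3) (nu : Z) (tau v : R) (x0 x1 : point) (k : mode K) : C :=
  if Z.eqb (kval k a) 0 then
    (RtoC v * Pi2 L M gam (cyc a nu) (translate x0 shape) k)%C
  else
    (- (/ fourier_symbol L (kval k a) * RtoC (/ tau) *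
        (Pi2 L M gam (cyc a nu) (translate x1 shape) k -
         Pi2 L M gam (cyc a nu) (translate x0 shape) k)))%C.

Definition Vhat3 (L : R) (M K : nat) (gam : mode K -> C) (shape : point -> C)
    (a : 'I_3) (tau v : R) (x0 x1 : point) (k : mode K) : C :=
  if Z.eqb (kval k a) 0 then
    (RtoC v * Pi3 L M gam (translate x0 shape) k)%C
  else
    (- (/ fourier_symbol L (kval k a) * RtoC (/ tau) *
        (Pi3 L M gam (translate x1 shape) k -
         Pi3 L M gam (translate x0 shape) k)))%C.

(* Main.v *)
(* During the step each particle moves on a straight line in direction a with
   constant velocity v.  Moving the particle translates the shape function, so
   d/dt F(S_X) = - v F(d_a S_X) for each conservative DFT functional F; this is
   differentiation under a bounded linear functional, uniform in the mesh
   variables because continuous periodic functions are uniformly continuous.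
   For k_a <> 0, v (2 i pi k_a / L)^-1 F(d_a S_X) is thus an exact time
   derivative; for k_a = 0 the functional averages over x_a and does not see the
   motion, so the source is constant in time.  With D_a D_(a+nu) = D_(a+nu) D_a
   (Schwarz) this gives explicit primitives of the right-hand sides for E_a and
   V_(a+nu).  Uniqueness holds: the positions, V_a and B are determined first,
   after which the two remaining right-hand sides are known functions of t.  In
   the existence part, V_(a+nu) is real because a sum of products of Hermitian
   coefficients is real. *)
From HB Require Import structures.
Require Import Defs.
From mathcomp Require Import all_boot.
From Stdlib Require Import Reals ZArith Lra Lia Classical ClassicalEpsilon.
From Stdlib Require Import FunctionalExtensionality ProofIrrelevance.
From Coquelicot Require Import Coquelicot.
Open Scope R_scope.

(** * Complex sums and elementary bounds on the modulus *)

HB.instance Definition _ :=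
  Monoid.isComLaw.Build C (RtoC 0) Cplus Cplus_assoc Cplus_comm Cplus_0_l.

Lemma Cconj_RtoC (x : R) : Cconj (RtoC x) = RtoC x.
Proof. by apply: injective_projections => /=; ring. Qed.

Lemma Cmod_le_Rabs (z : C) : Cmod z <= Rabs (Re z) + Rabs (Im z).
Proof.
have -> : z = (RtoC (Re z) + Ci * RtoC (Im z))%C.
  by apply: injective_projections; rewrite /= /Re /Im; ring.
apply: (Rle_trans _ _ _ (Cmod_triangle _ _)).
rewrite Cmod_mult !Cmod_R /Re /Im /=.
have -> : Cmod Ci = 1.
  by rewrite /Cmod /=; apply: etrans sqrt_1; congr (sqrt _); ring.
ring_simplify (z.1 + (0 * z.2 - 1 * 0)) (0 + (0 * 0 + 1 * z.2)).
by lra.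
Qed.

Lemma Rabs_im_le_Cmod (z : C) : Rabs (Im z) <= Cmod z.
Proof. exact: (Rle_trans _ _ _ (Rmax_r _ _) (Rmax_Cmod z)). Qed.

Lemma C_R_norm (z : C) : norm (V := C_R_NormedModule) z = Cmod z.
Proof.
rewrite /norm /= /prod_norm /Cmod /norm /= /abs /=.
congr (sqrt _).
by rewrite -!/(pow _ 2) !pow2_abs.
Qed.

(** * Uniform continuity and the one-dimensional functionals *)

(** The bound is non-strict and in [Cmod] because this is the form of bound that a functional of
    norm at most one preserves. The domain is arbitrary so that lines, pairs and points are handled
    alike. *)
Definition unif_cont {T : UniformSpace} (f : T -> C) : Prop :=
  forall eps : posreal, exists delta : posreal,
  forall x y : T, ball x delta y -> Cmod (f y - f x) <= eps.

Lemma unif_cont_comp (T T' : UniformSpace) (g : T' -> T) (f : T -> C) :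
  (forall (e : posreal) x y, ball x e y -> ball (g x) e (g y)) ->
  unif_cont f -> unif_cont (fun x => f (g x)).
Proof.
move=> gP fU eps; have [d dP] := fU eps; exists d => x y xy.
exact/dP/gP.
Qed.

Lemma unif_cont_lin (T : UniformSpace) (f g : T -> C) (c : C) :
  unif_cont f -> unif_cont g -> unif_cont (fun x => (f x + c * g x)%C).
Proof.
move=> fU gU eps.
have c0 := Cmod_ge_0 c.
have e1 : 0 < eps / 2 by have := cond_pos eps; lra.
(* Adding 1 keeps the denominator positive when [c] is 0. *)
have e2 : 0 < eps / 2 / (Cmod c + 1) by apply: Rdiv_lt_0_compat; lra.
have [d1 d1P] := fU (mkposreal _ e1); have [d2 d2P] := gU (mkposreal _ e2).
have d0 : 0 < Rmin d1 d2 by apply: Rmin_pos; apply: cond_pos.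
exists (mkposreal _ d0) => x y xy.
have := d1P x y (ball_le _ _ _ (Rmin_l _ _) _ xy).
have := d2P x y (ball_le _ _ _ (Rmin_r _ _) _ xy) => /= h2 h1.
have -> : (f y + c * g y - (f x + c * g x) = (f y - f x) + c * (g y - g x))%C.
  by ring.
apply: (Rle_trans _ _ _ (Cmod_triangle _ _)); rewrite Cmod_mult.
have h3 : Cmod c * Cmod (g y - g x) <= (Cmod c + 1) * (eps / 2 / (Cmod c + 1)).
  apply: Rmult_le_compat => //; [exact: Cmod_ge_0 | lra].
have h4 : (Cmod c + 1) * (eps / 2 / (Cmod c + 1)) = eps / 2 by field; lra.
by lra.
Qed.

Lemma unif_cont_continuous (T : UniformSpace) (f : T -> C) (x : T) :
  unif_cont f -> continuous f x.
Proof.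
move=> fU; apply/filterlim_locally => eps.
(* Balls are strict and [unif_cont] is not, so half of [eps] is requested. *)
have e1 : 0 < eps / 2 by have := cond_pos eps; lra.
have [d dP] := fU (mkposreal _ e1); exists d => y xy.
have /= h := dP x y xy.
have h1 := Rle_trans _ _ _ (re_le_Cmod _) h.
have h2 := Rle_trans _ _ _ (Rabs_im_le_Cmod _) h.
by split; apply: Rle_lt_trans (_ : eps / 2 < eps) => //; lra.
Qed.

Notation CInt := (RInt (V := C_R_CompleteNormedModule)).

Lemma ex_RInt_unif_cont (f : R -> C) (a b : R) :
  unif_cont f -> ex_RInt (V := C_R_CompleteNormedModule) f a b.
Proof.
move=> fU; apply: ex_RInt_continuous => z _; exact: unif_cont_continuous.
Qed.

Lemma unif_cont_const (T : UniformSpace) (c : C) : unif_cont (fun _ : T => c).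
Proof.
move=> eps; exists eps => x y _.
have -> : (c - c = RtoC 0)%C by ring.
by rewrite Cmod_0; have := cond_pos eps; lra.
Qed.

Lemma unif_cont_Cmult (T : UniformSpace) (f : T -> C) (c : C) :
  unif_cont f -> unif_cont (fun x => (c * f x)%C).
Proof.
move=> fU.
have -> : (fun x => (c * f x)%C) = (fun x => RtoC 0 + c * f x)%C.
  by apply: functional_extensionality => x; ring.
by apply: unif_cont_lin => //; apply: unif_cont_const.
Qed.

(** Complex linearity and operator norm at most 1 for the sup norm, on uniformly continuous
    functions. This treats the mean and the discrete transform alike and survives iteration over the
    variables. *)
Definition bounded_functional (Lam : (R -> C) -> C) : Prop :=
  (forall f g c, unif_cont f -> unif_cont g ->
     Lam (fun x => f x + c * g x)%C = (Lam f + c * Lam g)%C) /\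
  (forall f b, unif_cont f -> (forall x, Cmod (f x) <= b) -> Cmod (Lam f) <= b).

(** The integral is taken in a real normed module, so a complex scalar is pulled out through the
    real and imaginary parts. *)
Lemma RInt_Cmult (f : R -> C) (c : C) (a b : R) : unif_cont f ->
  CInt (fun x => c * f x)%C a b =
  (c * CInt f a b)%C.
Proof.
move=> fU; apply: is_RInt_unique.
have /RInt_correct := ex_RInt_unif_cont f a b fU.
set I := RInt _ _ _ => hI.
have h1 := is_RInt_fct_extend_fst _ _ _ _ hI.
have h2 := is_RInt_fct_extend_snd _ _ _ _ hI.
apply: is_RInt_fct_extend_pair => /=.
  exact: (is_RInt_minus _ _ _ _ _ _ (is_RInt_scal _ _ _ c.1 _ h1)
    (is_RInt_scal _ _ _ c.2 _ h2)).
exact: (is_RInt_plus _ _ _ _ _ _ (is_RInt_scal _ _ _ c.1 _ h2)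
    (is_RInt_scal _ _ _ c.2 _ h1)).
Qed.

Lemma RInt_Cconj (f : R -> C) (a b : R) : unif_cont f ->
  CInt (fun x => Cconj (f x)) a b =
  Cconj (CInt f a b).
Proof.
move=> fU; apply: is_RInt_unique.
have /RInt_correct := ex_RInt_unif_cont f a b fU.
set I := RInt _ _ _ => hI.
apply: is_RInt_fct_extend_pair => /=.
  exact: is_RInt_fct_extend_fst hI.
exact: (is_RInt_opp _ _ _ _ (is_RInt_fct_extend_snd _ _ _ _ hI)).
Qed.

Lemma Cmod_cis (x : R) : Cmod (cis x) = 1.
Proof.
rewrite /Cmod /cis /=; apply: etrans sqrt_1; congr (sqrt _).
have := sin2_cos2 x; rewrite /Rsqr; lra.
Qed.

(** Both branches are averages: an integral over a length [L] divided by [L], or [M] terms with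
    unimodular weights divided by [M]. *)
Lemma dft1_bounded (L : R) (M : nat) (k : Z) : 0 < L -> (0 < M)%nat ->
  bounded_functional (dft1 L M k).
Proof.
move=> L0 M0.
have M0' : 0 < INR M by apply: lt_0_INR; apply/ltP.
have M1 : RtoC (INR M) <> RtoC 0 by move=> /(f_equal fst) /=; lra.
split=> [f g c fU gU | f b fU fb]; rewrite /dft1; case: Z.eqb.
- have gU' := unif_cont_Cmult _ g c gU.
  rewrite (RInt_plus (V := C_R_CompleteNormedModule) f (fun x => c * g x)%C);
    try exact: ex_RInt_unif_cont.
  rewrite RInt_Cmult //.
  set I := CInt f _ _; set J := CInt g _ _.
  by change (plus I (c * J)%C) with (I + c * J)%C; ring.
- rewrite Cmult_assoc (Cmult_comm c) -Cmult_assoc -Cmult_plus_distr_l.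
  congr Cmult; elim/big_rec3: _ => [|j x y z _ ].
    by ring.
  by move=> ->; ring.
- rewrite Cmod_mult Cmod_R Rabs_pos_eq; last first.
    by apply/Rlt_le/Rinv_0_lt_compat.
  have h : Cmod (CInt f 0 L) <= L * b.
    rewrite -C_R_norm.
    apply: (norm_RInt_le (V := C_R_NormedModule) f (fun=> b) 0 L).
    + exact: Rlt_le.
    + by move=> x _; rewrite C_R_norm.
    + exact: RInt_correct (ex_RInt_unif_cont f 0 L fU).
    + have := is_RInt_const 0 L b.
      by rewrite /scal /= /mult /= Rminus_0_r.
  apply: (Rle_trans _ (/ L * (L * b))).
    by apply: Rmult_le_compat_l h; apply/Rlt_le/Rinv_0_lt_compat.
  by right; field; lra.
- rewrite Cmod_mult Cmod_R Rabs_pos_eq; last first.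
    by apply/Rlt_le/Rinv_0_lt_compat.
  pose s (j : nat) : C :=
    (f (INR j * (L / INR M))%R * cis (- (2 * PI * IZR k * INR j / INR M)))%C.
  have h (n : nat) :
      Cmod (\big[Cplus/RtoC 0]_(1 <= j < n.+1) s j) <= INR n * b.
    elim: n => [|n IH]; first by rewrite big_geq // Cmod_0 /=; lra.
    rewrite big_nat_recr //= -/(INR n.+1) S_INR.
    apply: (Rle_trans _ _ _ (Cmod_triangle _ _)).
    have := fb (INR n.+1 * (L / INR M)).
    rewrite /s Cmod_mult Cmod_cis Rmult_1_r; move: IH; rewrite /s; lra.
  apply: (Rle_trans _ (/ INR M * (INR M * b))).
    by apply: Rmult_le_compat_l (h M); apply/Rlt_le/Rinv_0_lt_compat.
  by right; field; lra.
Qed.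

Lemma dft1_conj (L : R) (M : nat) (k : Z) (f : R -> C) : unif_cont f ->
  dft1 L M (- k) (fun x => Cconj (f x)) = Cconj (dft1 L M k f).
Proof.
move=> fU; rewrite /dft1.
have -> : Z.eqb (- k) 0 = Z.eqb k 0 by case: k.
case: Z.eqb; first by rewrite RInt_Cconj // Cmult_conj Cconj_RtoC.
rewrite Cmult_conj Cconj_RtoC; congr Cmult.
rewrite (big_morph Cconj Cplus_conj (Cconj_RtoC 0)); apply: eq_bigr => j _.
rewrite Cmult_conj; congr Cmult; rewrite opp_IZR.
have -> : - (2 * PI * - IZR k * INR j / INR M) =
  - - (2 * PI * IZR k * INR j / INR M) by rewrite /Rdiv; ring.
by rewrite /cis /Cconj /= cos_neg sin_neg.
Qed.

(** The integral over [0, L + s] is split once at [s] and once at [L]; by periodicity the pieces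
    over [0, s] and [L, L + s] agree and cancel. *)
Lemma dft1_mean_shift (L : R) (M : nat) (f : R -> C) (s : R) : unif_cont f ->
  (forall x, f (x + L) = f x) ->
  dft1 L M 0 (fun x => f (x + s)) = dft1 L M 0 f.
Proof.
move=> fU fL; rewrite /dft1 /=; congr Cmult.
have ex a b := ex_RInt_unif_cont f a b fU.
have lin v a b : CInt (fun x => f (x + v)) a b =
    CInt f (a + v) (b + v).
  have := RInt_comp_lin (V := C_R_CompleteNormedModule) f 1 v a b (ex _ _).
  rewrite !Rmult_1_l => <-; apply: RInt_ext => x _.
  by rewrite scal_one Rmult_1_l.
rewrite lin.
have h : CInt f L (L + s) =
    CInt f 0 s.
  have := lin L 0 s; rewrite Rplus_0_l (Rplus_comm s) => <-.
  by apply: RInt_ext => x _; rewrite fL.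
have h1 := RInt_Chasles (V := C_R_CompleteNormedModule) f 0 s (L + s)
  (ex _ _) (ex _ _).
have h2 := RInt_Chasles (V := C_R_CompleteNormedModule) f 0 L (L + s)
  (ex _ _) (ex _ _).
move: h1; rewrite -h2 h plus_comm => /(plus_reg_r _ _ _) h1.
by rewrite Rplus_0_l.
Qed.

(** * The three-dimensional functional *)

(** The modulus of continuity of [F] is inherited: a difference of values is [Lam] of a difference
    of slices. Hence eliminating one variable leaves a function to which the next functional
    applies. *)
Lemma functional_unif_cont (T : UniformSpace) (Lam : (R -> C) -> C)
    (F : T * R -> C) : bounded_functional Lam ->
  unif_cont F -> unif_cont (fun t => Lam (fun x => F (t, x))).
Proof.
move=> [lin bnd] FU eps; have [d dP] := FU eps; exists d => t t' tt'.
have slice u : unif_cont (fun x => F (u, x)).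
  apply: (unif_cont_comp _ _ (fun x => (u, x))) FU => e x y xy.
  by split => //; apply: ball_center.
have -> : (Lam (fun x => F (t', x)) - Lam (fun x => F (t, x)) =
    Lam (fun x => F (t', x)) + (- RtoC 1) * Lam (fun x => F (t, x)))%C by ring.
rewrite -lin //; apply: bnd; first exact: unif_cont_lin.
move=> x.
have -> : (F (t', x) + - RtoC 1 * F (t, x) = F (t', x) - F (t, x))%C by ring.
by apply: dP; split => //; apply: ball_center.
Qed.

Lemma kval_opp (K : nat) (k : mode K) (a : 'I_3) :
  kval (mode_opp k) a = (- kval k a)%Z.
Proof.
rewrite /kval ffunE /=.
have := ltn_ord (k a); move: (nat_of_ord (k a)) => n; rewrite ltnS subSS => h.
by rewrite Nat2Z.inj_sub ?Nat2Z.inj_mul; [lia | apply/leP].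
Qed.

Section DFT.

Variables (L : R) (M K : nat) (k : mode K).
Hypotheses (L_gt0 : 0 < L) (M_gt0 : (0 < M)%nat).

Let Lam (i : nat) := dft1 L M (kval k (inord i)).

Let Lam_bounded i : bounded_functional (Lam i).
Proof. exact: dft1_bounded. Qed.

(** Intermediate stages of the tensor product, with the third variable eliminated, then also the
    second. *)
Let Lam2 (G : point -> C) (u : R * R) := Lam 2 (fun x => G (point3 u.1 u.2 x)).
Let Lam1 (G : point -> C) (x : R) := Lam 1 (fun y => Lam2 G (x, y)).

Let point3_unif_cont (G : point -> C) : unif_cont G ->
  unif_cont (fun u : R * R * R => G (point3 u.1.1 u.1.2 u.2)).
Proof.
apply: (unif_cont_comp _ _ (fun u : R * R * R => point3 u.1.1 u.1.2 u.2)).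
move=> e x y [[b1 b2] b3] [[|[|[|i]]] Hi] //.
Qed.

Let Lam2_unif_cont (G : point -> C) : unif_cont G -> unif_cont (Lam2 G).
Proof.
move=> GU; apply: (functional_unif_cont _ _
  (fun u : R * R * R => G (point3 u.1.1 u.1.2 u.2))) => //.
exact: point3_unif_cont.
Qed.

Let Lam1_unif_cont (G : point -> C) : unif_cont G -> unif_cont (Lam1 G).
Proof.
move=> GU; apply: (functional_unif_cont _ _
  (fun u : R * R => Lam2 G (u.1, u.2))) => //.
apply: (unif_cont_comp _ _ (fun u => (u.1, u.2))); last exact: Lam2_unif_cont.
by move=> e x y [].
Qed.

Let line3_unif_cont (G : point -> C) (u : R * R) :
  unif_cont G -> unif_cont (fun x => G (point3 u.1 u.2 x)).
Proof.
move=> GU.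
apply: (unif_cont_comp _ _ (fun x : R => (u, x)) _ _ (point3_unif_cont _ GU)).
by move=> e x y xy; split => //; apply: ball_center.
Qed.

Let line2_unif_cont (G : point -> C) (x : R) :
  unif_cont G -> unif_cont (fun y => Lam2 G (x, y)).
Proof.
move=> GU.
apply: (unif_cont_comp _ _ (fun y : R => (x, y)) _ _ (Lam2_unif_cont _ GU)).
by move=> e y z yz; split => //; apply: ball_center.
Qed.

Let dftE (G : point -> C) : dft L M k G = Lam 0 (Lam1 G).
Proof. by []. Qed.

Lemma dft_lin (F G : point -> C) (c : C) : unif_cont F -> unif_cont G ->
  dft L M k (fun x => F x + c * G x)%C = (dft L M k F + c * dft L M k G)%C.
Proof.
move=> FU GU; rewrite !dftE -(Lam_bounded 0).1; try exact: Lam1_unif_cont.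
congr (Lam 0); apply: functional_extensionality => x.
rewrite /Lam1 -(Lam_bounded 1).1; try exact: line2_unif_cont.
congr (Lam 1); apply: functional_extensionality => y.
by rewrite /Lam2 -(Lam_bounded 2).1 //; apply: line3_unif_cont.
Qed.

Lemma Cmod_dft_le (G : point -> C) (b : R) : unif_cont G ->
  (forall x, Cmod (G x) <= b) -> Cmod (dft L M k G) <= b.
Proof.
move=> GU Gb; apply: (Lam_bounded 0).2 => [|x]; first exact: Lam1_unif_cont.
apply: (Lam_bounded 1).2 => [|y]; first exact: line2_unif_cont.
by apply: (Lam_bounded 2).2 => [|z //]; apply: (line3_unif_cont G (x, y)).
Qed.

(** The shift touches one tensor factor only. The functionals outside it are stripped by congruence,
    and [dft1_mean_shift] applies to the stage seen by that factor, which inherits periodicity. *)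
Lemma dft_mean_shift (G : point -> C) (a : 'I_3) (s : R) : unif_cont G ->
  (forall x, G (upd x a (x a + L)) = G x) -> kval k a = 0%Z ->
  dft L M k (fun x => G (upd x a (x a + s))) = dft L M k G.
Proof.
move=> GU Gper ka0.
have updE x y z t : upd (point3 x y z) a (point3 x y z a + t) =
    match nat_of_ord a with
    | 0%nat => point3 (x + t) y z
    | 1%nat => point3 x (y + t) z
    | _ => point3 x y (z + t)
    end.
  apply: functional_extensionality => b; rewrite /upd -val_eqE.
  by case: a {Gper ka0} => [[|[|[|i]]] Hi] //=; case: b => [[|[|[|j]]] Hj].
have aE : a = inord a by apply: val_inj; rewrite /= inordK.
have per x y z := Gper (point3 x y z).
rewrite !dftE.
case: (nat_of_ord a) (ltn_ord a) updE aE => [|[|[|//]]] _ updE aE.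
- rewrite /Lam -aE ka0.
  rewrite -(dft1_mean_shift L M (Lam1 G) s); last 1 first.
  + move=> x; rewrite /Lam1.
    congr (Lam 1); apply: functional_extensionality => y; rewrite /Lam2.
    congr (Lam 2).
    by apply: functional_extensionality => z /=; rewrite -(per x y z) updE.
  + congr dft1; apply: functional_extensionality => x; rewrite /Lam1.
    congr (Lam 1); apply: functional_extensionality => y; rewrite /Lam2.
    congr (Lam 2).
    by apply: functional_extensionality => z; rewrite updE.
  + exact: Lam1_unif_cont.
- congr (Lam 0); apply: functional_extensionality => x.
  rewrite /Lam1 /Lam -aE ka0.
  rewrite -(dft1_mean_shift L M (fun y => Lam2 G (x, y)) s); last 1 first.
  + move=> y; rewrite /Lam2.
    congr (Lam 2).
    by apply: functional_extensionality => z /=; rewrite -(per x y z) updE.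
  + congr dft1; apply: functional_extensionality => y; rewrite /Lam2.
    congr (Lam 2).
    by apply: functional_extensionality => z; rewrite updE.
  + exact: line2_unif_cont.
- congr (Lam 0); apply: functional_extensionality => x; rewrite /Lam1.
  congr (Lam 1); apply: functional_extensionality => y.
  rewrite /Lam2 /Lam -aE ka0.
  rewrite -(dft1_mean_shift L M (fun z => G (point3 x y z)) s); last 1 first.
  + by move=> z; rewrite -(per x y z) updE.
  + congr dft1; apply: functional_extensionality => z.
    by rewrite updE.
  + exact: (line3_unif_cont G (x, y)).
Qed.

(** [dft1_conj] in each variable, from the outside in. For real [G] this is the Hermitian symmetry
    of the coefficients. *)
Lemma dft_conj (G : point -> C) : unif_cont G ->
  dft L M (mode_opp k) (fun x => Cconj (G x)) = Cconj (dft L M k G).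
Proof.
move=> GU.
rewrite dftE -dft1_conj; last exact: Lam1_unif_cont.
rewrite /dft !kval_opp; congr dft1; apply: functional_extensionality => x.
rewrite -dft1_conj; last exact: line2_unif_cont.
congr dft1; apply: functional_extensionality => y.
by rewrite -dft1_conj //; apply: (line3_unif_cont G (x, y)).
Qed.

End DFT.

(** * Periodic functions and derivatives *)

Lemma point3E (x : point) :
  x = point3 (x (inord 0)) (x (inord 1)) (x (inord 2)).
Proof.
apply: functional_extensionality => -[[|[|[|i]]] Hi] //=;
  by congr x; apply: val_inj; rewrite /= inordK.
Qed.

Lemma periodic_shift_INR (L : R) (G : point -> C) (a : 'I_3) (x : point)
    (j : nat) : (forall x, G (upd x a (x a + L)) = G x) ->
  G (upd x a (x a + L * INR j)) = G x.
Proof.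
move=> Gper; elim: j => [|j IH].
  congr G; apply: functional_extensionality => b; rewrite /upd.
  by case: eqP => // ->; rewrite /=; ring.
rewrite -IH -[RHS]Gper; congr G; apply: functional_extensionality => b.
by rewrite S_INR /upd eqxx; case: eqP => // _; ring.
Qed.

Lemma periodic_shift_IZR (L : R) (G : point -> C) (a : 'I_3) (x : point)
    (n : Z) : (forall x, G (upd x a (x a + L)) = G x) ->
  G (upd x a (x a + L * IZR n)) = G x.
Proof.
move=> Gper; have [n0|n0] := Z.le_gt_cases 0 n.
  by rewrite -(Z2Nat.id n n0) -INR_IZR_INZ periodic_shift_INR.
rewrite -[LHS](periodic_shift_INR _ _ a _ (Z.to_nat (- n)) Gper).
congr G; apply: functional_extensionality => b.
rewrite INR_IZR_INZ Z2Nat.id; last lia.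
by rewrite opp_IZR /upd eqxx; case: eqP => // ->; ring.
Qed.

Lemma periodic_shift (L : R) (G : point -> C) (x : point) (n : 'I_3 -> Z) :
  (forall a x, G (upd x a (x a + L)) = G x) ->
  G (fun b => x b + L * IZR (n b)) = G x.
Proof.
move=> Gper.
(* Interpolates between the two points: the first [i] coordinates are already shifted, so
   consecutive stages differ in one coordinate. *)
pose y (i : nat) : point :=
  fun b => if (b < i)%nat then x b + L * IZR (n b) else x b.
have step i : (i < 3)%nat -> G (y i.+1) = G (y i).
  move=> i3; rewrite -[RHS](periodic_shift_IZR L _ (inord i) _ (n (inord i))) //.
  congr G; apply: functional_extensionality => b; rewrite /y /upd.
  rewrite -val_eqE /= inordK // ltnS leq_eqVlt.
  case: eqP => [bi|_ //] /=.
  have -> : inord i = b by rewrite -bi; apply: val_inj; rewrite /= inordK.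
  by rewrite ltnn.
transitivity (G (y 0%nat)); last by [].
rewrite -(step 0%nat) // -(step 1%nat) // -(step 2%nat) //.
congr G; apply: functional_extensionality => b.
by rewrite /y ltn_ord.
Qed.

(** A Lebesgue number argument on the cube [0, L]^3. One lattice vector moves [x] into the cube and
    is applied to [z] too; [z'] may leave the cube, since only its distance to [x'] matters. *)
Lemma C0per_unif_cont (L : R) (G : point -> C) : 0 < L ->
  C0per L G -> unif_cont G.
Proof.
move=> L0 [Gcont Gper] eps.
(* Balls in C are componentwise, so [eps / 4] gives a modulus at most [eps / 2]; two comparisons
   with a common centre add up to [eps]. *)
have e0 : 0 < eps / 4 by have := cond_pos eps; lra.
have loc (t : point) : { d : posreal | forall y, ball t d y ->
    ball (G t) (eps / 4) (G y) }.
  apply: constructive_indefinite_description.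
  by have /filterlim_locally /(_ (mkposreal _ e0)) [d dP] := Gcont t; exists d.
pose pt (u : Compactness.Tn 3 R) := point3 u.1 u.2.1 u.2.2.1.
(* Half the radius is spent from the centre to [x'], the other half from [x'] to [z']. *)
pose half (u : Compactness.Tn 3 R) := pos_div_2 (sval (loc (pt u))).
have [d dP] := compactness_value 3 (0, (0, (0, tt))) (L, (L, (L, tt))) half.
exists d => x z xz.
pose n b := Int_part (x b / L).
have xn b : 0 <= x b - L * IZR (n b) <= L.
  have [] := base_Int_part (x b / L); rewrite -/(n b) => h1 h2.
  have -> : x b - L * IZR (n b) = L * (x b / L - IZR (n b)) by field; lra.
  split; first by apply: Rmult_le_pos; lra.
  by rewrite -[X in _ <= X](Rmult_1_r L); apply: Rmult_le_compat_l; lra.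
pose x' : point := fun b => x b + L * IZR (- n b).
pose z' : point := fun b => z b + L * IZR (- n b).
rewrite -(periodic_shift L G x (fun b => (- n b)%Z) Gper).
rewrite -(periodic_shift L G z (fun b => (- n b)%Z) Gper) -/x' -/z'.
have xb b : 0 <= x' b <= L.
  by rewrite /x' opp_IZR; have := xn b; lra.
pose u : Compactness.Tn 3 R :=
  (x' (inord 0), (x' (inord 1), (x' (inord 2), tt))).
have ub : bounded_n 3 (0, (0, (0, tt))) (L, (L, (L, tt))) u.
  by do !split; apply xb.
(* Compactness yields the centre only under a double negation, so the goal is negated as well. *)
apply: NNPP => contra; apply: (dP u ub) => -[[t1 [t2 [t3 []]]]].
set t : Compactness.Tn 3 R := (t1, (t2, (t3, tt))).
move=> [_ [[c1 [c2 [c3 _]]]]].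
move: c1 c2 c3; rewrite /half; case: (loc (pt t)) => e eP /= c1 c2 c3 de.
have tx b : Rabs (x' b - pt t b) < e / 2.
  rewrite (point3E x'); case: b => [[|[|[|i]]] Hi] //.
apply: contra.
have hx : ball (G (pt t)) (eps / 4) (G x').
  apply: eP => b; apply: Rlt_le_trans (tx b) _.
  by have := cond_pos e; lra.
have hz : ball (G (pt t)) (eps / 4) (G z').
  apply: eP => b; have := xz b; have := tx b.
  rewrite /ball /= /AbsRing_ball /abs /= /minus /plus /opp /= => h1 h2.
  have -> : z' b + - pt t b = (x' b - pt t b) + (z b + - x b).
    by rewrite /z' /x'; ring.
  by apply: (Rle_lt_trans _ _ _ (Rabs_triang _ _)); lra.
have cm (w : point) : ball (G (pt t)) (eps / 4) (G w) ->
    Cmod (G w - G (pt t)) <= eps / 2.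
  move=> [h1 h2]; apply: (Rle_trans _ _ _ (Cmod_le_Rabs _)).
  have {}h1 : Rabs (Re (G w - G (pt t))) < eps / 4 := h1.
  have {}h2 : Rabs (Im (G w - G (pt t))) < eps / 4 := h2.
  by lra.
have -> : (G z' - G x' = (G z' - G (pt t)) + - (G x' - G (pt t)))%C by ring.
apply: (Rle_trans _ _ _ (Cmod_triangle _ _)); rewrite Cmod_opp.
by have := cm _ hx; have := cm _ hz; lra.
Qed.

(** * Derivatives of complex-valued functions of a real variable *)

Lemma is_derive_C_components (f : R -> C) (t : R) (l : C) :
  is_derive (V := C_R_NormedModule) f t l <->
  is_derive (fun s => Re (f s)) t (Re l) /\
  is_derive (fun s => Im (f s)) t (Im l).
Proof.
split=> [fl|[f1 f2]].
  split.
    apply: (filterdiff_comp (V := C_R_NormedModule) f fst _ fst fl).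
    by apply: filterdiff_linear; apply: is_linear_fst.
  apply: (filterdiff_comp (V := C_R_NormedModule) f snd _ snd fl).
  by apply: filterdiff_linear; apply: is_linear_snd.
have h1 := is_derive_scal_l (V := C_R_NormedModule) _ _ _ (RtoC 1) f1.
have h2 := is_derive_scal_l (V := C_R_NormedModule) _ _ _ Ci f2.
have := is_derive_plus (V := C_R_NormedModule) _ _ _ _ _ h1 h2.
have e (z : C) : plus (G := C_R_NormedModule)
    (scal (V := C_R_NormedModule) (Re z) (RtoC 1))
    (scal (V := C_R_NormedModule) (Im z) Ci) = z.
  case: z => x y.
  change ((x * 1 + y * 0, x * 0 + y * 1) = (x, y)).
  by congr pair; ring.
rewrite e; apply: is_derive_ext => s; exact: e.
Qed.

Lemma is_derive_C_eps (f : R -> C) (t : R) (l : C) :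
  (forall eps : posreal, exists d : posreal, forall h, Rabs h < d ->
     Cmod (f (t + h)%R - f t - RtoC h * l) <= eps * Rabs h) ->
  is_derive (V := C_R_NormedModule) f t l.
Proof.
move=> H; split; first exact: is_linear_scal_l.
move=> t' /is_filter_lim_locally_unique <- eps.
have [d dP] := H eps; exists d => s ts.
rewrite C_R_norm.
have := dP (s - t) ts.
have -> : t + (s - t) = s by ring.
have -> : (RtoC (s - t) * l)%C = ((s - t) * l.1, (s - t) * l.2).
  by apply: injective_projections => /=; ring.
by [].
Qed.

(** The mean value inequality is applied to the real and imaginary parts separately, which costs the
    factor 2. *)
Lemma C_bounded_variation (f df : R -> C) (b x y : R) :
  (forall t, Rabs (t - x) <= Rabs (y - x) ->
     is_derive (V := C_R_NormedModule) f t (df t) /\ Cmod (df t) <= b) ->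
  Cmod (f y - f x) <= 2 * b * Rabs (y - x).
Proof.
move=> H.
have h1 : Rabs (Re (f y) - Re (f x)) <= b * Rabs (y - x).
  apply: (bounded_variation (fun t => Re (f t)) (fun t => Re (df t))) => t /H.
  rewrite is_derive_C_components => -[[? _] h]; split=> //.
  exact: Rle_trans (re_le_Cmod _) h.
have h2 : Rabs (Im (f y) - Im (f x)) <= b * Rabs (y - x).
  apply: (bounded_variation (fun t => Im (f t)) (fun t => Im (df t))) => t /H.
  rewrite is_derive_C_components => -[[_ ?] h]; split=> //.
  exact: Rle_trans (Rabs_im_le_Cmod _) h.
apply: (Rle_trans _ _ _ (Cmod_le_Rabs _)).
have {}h1 : Rabs (Re (f y - f x)) <= b * Rabs (y - x) := h1.
have {}h2 : Rabs (Im (f y - f x)) <= b * Rabs (y - x) := h2.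
by lra.
Qed.

(** * Partial derivatives and translations *)

Lemma upd_same (x : point) (a : 'I_3) (t : R) : upd x a t a = t.
Proof. by rewrite /upd eqxx. Qed.

Lemma upd_other (x : point) (a b : 'I_3) (t : R) : b <> a -> upd x a t b = x b.
Proof. by rewrite /upd => /eqP /negbTE ->. Qed.

Lemma upd_id (x : point) (a : 'I_3) : upd x a (x a) = x.
Proof.
by apply: functional_extensionality => b; rewrite /upd; case: eqP => [->|].
Qed.

Lemma upd_upd (x : point) (a : 'I_3) (t u : R) : upd (upd x a t) a u = upd x a u.
Proof. by apply: functional_extensionality => b; rewrite /upd; case: eqP. Qed.

Lemma upd_comm (x : point) (a b : 'I_3) (t u : R) : a <> b ->
  upd (upd x a t) b u = upd (upd x b u) a t.
Proof.
move=> ab; apply: functional_extensionality => c; rewrite /upd.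
by case: eqP => // ->; case: eqP => // ba; case: ab.
Qed.

(* [unif_cont] replaces continuity, to which it is equivalent for periodic
   functions. *)
Record C1dir (L : R) (a : 'I_3) (G : point -> C) : Prop := MkC1dir {
  C1dir_uc : unif_cont G;
  C1dir_uc_pderiv : unif_cont (pderiv a G);
  C1dir_per : forall x, G (upd x a (x a + L)) = G x;
  C1dir_derive : forall x, is_derive (V := C_R_NormedModule)
    (fun t => G (upd x a t)) (x a) (pderiv a G x)
}.

Lemma C1dir_derive_upd (L : R) (a : 'I_3) (G : point -> C) (x : point) (t : R) :
  C1dir L a G -> is_derive (V := C_R_NormedModule)
    (fun u => G (upd x a u)) t (pderiv a G (upd x a t)).
Proof.
move=> /C1dir_derive /(_ (upd x a t)); rewrite upd_same.
by apply: is_derive_ext => u; rewrite upd_upd.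
Qed.

Lemma C1per_C1dir (L : R) (G : point -> C) (s : seq 'I_3) (a : 'I_3) : 0 < L ->
  C1per L G -> uniq (a :: s) -> C1dir L a (mixed s G).
Proof.
move=> L0 GC /= /andP[as_ us].
have [sC sD] := GC s us.
have [|asC _] := GC (a :: s); first by rewrite /= as_.
split; first exact: C0per_unif_cont sC.
- exact: C0per_unif_cont asC.
- by move=> x; rewrite sC.2.
- by move=> x; apply: sD.
Qed.

(** Schwarz's theorem is about real functions of two variables. Here [phi] stands for [Re] or [Im],
    of which only compatibility with derivatives and the Lipschitz bound matter. *)
Lemma pderiv_comm_component (L : R) (G : point -> C) (a b : 'I_3) (x : point)
    (phi : C -> R) :
  (forall (f : R -> C) t l, is_derive (V := C_R_NormedModule) f t l ->
     is_derive (fun s => phi (f s)) t (phi l)) ->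
  (forall z w, Rabs (phi w - phi z) <= Cmod (w - z)) ->
  0 < L -> C1per L G -> a <> b ->
  phi (pderiv a (pderiv b G) x) = phi (pderiv b (pderiv a G) x).
Proof.
move=> phiD phiC L0 GC ab.
have ab' : (a == b) = false by apply/eqP.
have ba' : (b == a) = false by rewrite eq_sym.
(* The plane through [x] in directions [a] and [b], the remaining coordinate being frozen. *)
pose P u v := upd (upd x a u) b v.
have da H u v : C1dir L a H ->
    is_derive (fun t => phi (H (P t v))) u (phi (pderiv a H (P u v))).
  move=> HC; rewrite /P (upd_comm _ _ _ _ _ ab).
  apply: (is_derive_ext (fun t => phi (H (upd (upd x b v) a t)))).
    by move=> t; rewrite (upd_comm _ _ _ _ _ ab).
  exact: (phiD _ _ _ (C1dir_derive_upd _ _ _ _ _ HC)).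
have db H u v : C1dir L b H ->
    is_derive (fun t => phi (H (P u t))) v (phi (pderiv b H (P u v))).
  by move=> HC; apply: (phiD _ _ _ (C1dir_derive_upd _ _ _ _ _ HC)).
have Ga : C1dir L a G by apply: (C1per_C1dir _ _ [::]).
have Gb : C1dir L b G by apply: (C1per_C1dir _ _ [::]).
have Gab : C1dir L a (pderiv b G).
  by apply: (C1per_C1dir _ _ [:: b]); rewrite //= inE ab'.
have Gba : C1dir L b (pderiv a G).
  by apply: (C1per_C1dir _ _ [:: a]); rewrite //= inE ba'.
pose f u v := phi (G (P u v)).
have e1 u v : Derive (fun t => f u t) v = phi (pderiv b G (P u v)).
  by apply: is_derive_unique; apply: db.
have e2 u v : Derive (fun t => f t v) u = phi (pderiv a G (P u v)).
  by apply: is_derive_unique; apply: da.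
have e12 u v :
    Derive (fun z => Derive (fun t => f z t) v) u =
    phi (pderiv a (pderiv b G) (P u v)).
  rewrite (Derive_ext _ (fun z => phi (pderiv b G (P z v)))) //.
  by apply: is_derive_unique; apply: da.
have e21 u v :
    Derive (fun z => Derive (fun t => f t z) u) v =
    phi (pderiv b (pderiv a G) (P u v)).
  rewrite (Derive_ext _ (fun z => phi (pderiv a G (P u z)))) //.
  by apply: is_derive_unique; apply: db.
have cont H u v : unif_cont H ->
    continuity_2d_pt (fun u v => phi (H (P u v))) u v.
  move=> HU eps.
  have e0 : 0 < eps / 2 by have := cond_pos eps; lra.
  have [d dP] := HU (mkposreal _ e0); exists d => u' v' uu' vv'.
  apply: (Rle_lt_trans _ _ _ (phiC _ _)).
  apply: (Rle_lt_trans _ (eps / 2)); last by have := cond_pos eps; lra.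
  apply: dP => c; rewrite /P /upd.
  by do 2 case: eqP => _ //; apply: ball_center.
have PE : P (x a) (x b) = x by rewrite /P upd_id upd_id.
rewrite -PE -e12 -e21; apply: Schwarz.
- exists (mkposreal _ Rlt_0_1) => u v _ _; split.
    by exists (phi (pderiv a G (P u v))); apply: da.
  split; first by exists (phi (pderiv b G (P u v))); apply: db.
  split.
    exists (phi (pderiv a (pderiv b G) (P u v))).
    by apply: (is_derive_ext _ _ _ _ (fun z => esym (e1 z v))); apply: da.
  exists (phi (pderiv b (pderiv a G) (P u v))).
  by apply: (is_derive_ext _ _ _ _ (fun z => esym (e2 u z))); apply: db.
- apply: (continuity_2d_pt_ext (fun u v => phi (pderiv a (pderiv b G) (P u v)))).
    by move=> u v; rewrite e12.
  exact/cont/(C1dir_uc_pderiv _ _ _ Gab).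
- apply: (continuity_2d_pt_ext (fun u v => phi (pderiv b (pderiv a G) (P u v)))).
    by move=> u v; rewrite e21.
  exact/cont/(C1dir_uc_pderiv _ _ _ Gba).
Qed.

Lemma pderiv_comm (L : R) (G : point -> C) (a b : 'I_3) :
  0 < L -> C1per L G -> a <> b ->
  pderiv a (pderiv b G) = pderiv b (pderiv a G).
Proof.
move=> L0 GC ab; apply: functional_extensionality => x.
have re := pderiv_comm_component L G a b x Re _ _ L0 GC ab.
have im := pderiv_comm_component L G a b x Im _ _ L0 GC ab.
apply: injective_projections; [apply: re | apply: im].
- by move=> f t l /is_derive_C_components [].
- by move=> z w; apply: (re_le_Cmod (w - z)).
- by move=> f t l /is_derive_C_components [].
- by move=> z w; apply: (Rabs_im_le_Cmod (w - z)).
Qed.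

(** The difference quotients coincide, so no differentiability is involved; translations thus
    commute with [pderiv] for arbitrary functions. *)
Lemma Derive_shift (f : R -> R) (c x : R) :
  Derive (fun t => f (t - c)) x = Derive f (x - c).
Proof.
rewrite /Derive; congr real; apply: Lim_ext => h; congr (_ / _); congr (f _ - _).
by ring.
Qed.

Lemma translate_upd (y x : point) (a : 'I_3) (G : point -> C) (t : R) :
  translate y G (upd x a t) = G (upd (fun b => x b - y b) a (t - y a)).
Proof.
rewrite /translate; congr G; apply: functional_extensionality => b.
by rewrite /upd; case: eqP => [->|].
Qed.

Lemma pderiv_translate (y : point) (a : 'I_3) (G : point -> C) :
  pderiv a (translate y G) = translate y (pderiv a G).
Proof.
apply: functional_extensionality => x; rewrite {2}/translate /pderiv.
by congr pair; rewrite -Derive_shift; apply: Derive_ext => t;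
  rewrite translate_upd.
Qed.

Lemma Dtilde_translate (K : nat) (k : mode K) (y : point) (a : 'I_3)
    (G : point -> C) :
  Dtilde k a (translate y G) = translate y (Dtilde k a G).
Proof. by rewrite /Dtilde pderiv_translate; case: Z.eqb. Qed.

Lemma unif_cont_translate (y : point) (G : point -> C) :
  unif_cont G -> unif_cont (translate y G).
Proof.
apply: (unif_cont_comp _ _ (fun (x : point) a => x a - y a)).
move=> e x x' xx' a; have := xx' a.
rewrite /ball /= /AbsRing_ball /minus /plus /opp /= /abs /=.
by have -> : x' a - y a + - (x a - y a) = x' a + - x a by ring.
Qed.

(** By linearity the Taylor remainder of the coefficient is [dft] of the pointwise remainder, which
    uniform continuity of [pderiv a G] bounds by [eps * Rabs h] uniformly in the mesh variables. The
    sign arises because moving the particle forward moves the argument of [G] backward. *)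
Lemma dft_translate_derive (L : R) (M K : nat) (k : mode K) (G : point -> C)
    (a : 'I_3) (x0 : point) (s : R) : 0 < L -> (0 < M)%nat -> C1dir L a G ->
  is_derive (V := C_R_NormedModule)
    (fun u => dft L M k (translate (upd x0 a u) G)) s
    (- dft L M k (translate (upd x0 a s) (pderiv a G)))%C.
Proof.
move=> L0 M0 GC; apply: is_derive_C_eps => eps.
have e0 : 0 < eps / 2 by have := cond_pos eps; lra.
have [d dP] := C1dir_uc_pderiv _ _ _ GC (mkposreal _ e0).
exists d => h hd.
have uc u := unif_cont_translate (upd x0 a u) _ (C1dir_uc _ _ _ GC).
have ucd := unif_cont_translate (upd x0 a s) _ (C1dir_uc_pderiv _ _ _ GC).
have -> : (dft L M k (translate (upd x0 a (s + h)) G) -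
    dft L M k (translate (upd x0 a s) G) -
    RtoC h * - dft L M k (translate (upd x0 a s) (pderiv a G)) =
    dft L M k (fun x => (translate (upd x0 a (s + h)) G x +
      - RtoC 1 * translate (upd x0 a s) G x) +
      RtoC h * translate (upd x0 a s) (pderiv a G) x))%C.
  rewrite !dft_lin //; first ring.
  exact: unif_cont_lin.
apply: Cmod_dft_le => // [|x].
  by apply: unif_cont_lin => //; apply: unif_cont_lin.
pose w : point := fun b => x b - x0 b.
have tr (H : point -> C) u : translate (upd x0 a u) H x = H (upd w a (x a - u)).
  rewrite /translate; congr H; apply: functional_extensionality => b.
  by rewrite /upd; case: eqP => [->|].
rewrite !tr.
pose D := pderiv a G (upd w a (x a - s)).
(* The remainder is an increment of [psi], whose derivative is [D] minus a nearby value of the same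
   partial derivative, hence small. *)
pose psi u := (G (upd w a (x a - u)) + RtoC u * D)%C.
have -> : (G (upd w a (x a - (s + h))) + - RtoC 1 * G (upd w a (x a - s)) +
    RtoC h * pderiv a G (upd w a (x a - s)) = psi (s + h)%R - psi s)%C.
  rewrite /psi -/D; have -> : RtoC (s + h) = (RtoC s + RtoC h)%C.
    by rewrite RtoC_plus.
  by ring.
have -> : eps * Rabs h = 2 * (eps / 2) * Rabs (s + h - s).
  have -> : s + h - s = h by ring.
  by field.
apply: (C_bounded_variation _
  (fun u => - pderiv a G (upd w a (x a - u)) + D)%C) => u.
have -> : s + h - s = h by ring.
move=> us; split.
- apply: (is_derive_plus (V := C_R_NormedModule)).
    have h1 : is_derive (fun u => x a - u) u (- 1) by auto_derive => //; ring.
    have := is_derive_comp (V := C_R_NormedModule) _ _ _ _ _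
      (C1dir_derive_upd _ _ _ w (x a - u) GC) h1.
    rewrite (_ : scal (V := C_R_NormedModule) _ _ =
      (- pderiv a G (upd w a (x a - u)))%C) //.
    case: pderiv => p1 p2.
    change (((- 1) * p1, (- 1) * p2) = (- p1, - p2)).
    by congr pair; ring.
  have := is_derive_scal_l (V := C_R_NormedModule) _ _ _ D (is_derive_id u).
  rewrite (_ : scal (V := C_R_NormedModule) _ _ = D); last first.
    exact: (scal_one (V := C_R_NormedModule)).
  apply: is_derive_ext => t.
  change ((t * D.1, t * D.2) = (RtoC t * D)%C).
  by apply: injective_projections => /=; ring.
- have := dP (upd w a (x a - s)) (upd w a (x a - u)).
  have -> : (- pderiv a G (upd w a (x a - u)) + D =
    - (pderiv a G (upd w a (x a - u)) - D))%C by ring.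
  rewrite Cmod_opp /=; apply => b; rewrite /upd.
  case: eqP => _; last exact: ball_center.
  rewrite /ball /= /AbsRing_ball /minus /plus /opp /= /abs /=.
  have -> : x a - u + - (x a - s) = - (u - s) by ring.
  by rewrite Rabs_Ropp; apply: Rle_lt_trans us hd.
Qed.

(** * Symbols and Hermitian symmetry *)

Lemma fourier_symbolE (L : R) (n : Z) : L <> 0 ->
  fourier_symbol L n = (0, 2 * PI * IZR n / L).
Proof.
move=> L0.
have L1 : RtoC L <> RtoC 0 by move=> /(f_equal fst).
rewrite /fourier_symbol /Cdiv -RtoC_inv //.
by apply: injective_projections => /=; field.
Qed.

Lemma fourier_symbol_neq0 (L : R) (n : Z) : 0 < L -> n <> 0%Z ->
  fourier_symbol L n <> RtoC 0.
Proof.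
move=> L0 n0; rewrite fourier_symbolE; last lra.
move=> /(f_equal snd) /=.
apply: Rmult_integral_contrapositive_currified.
  apply: Rmult_integral_contrapositive_currified; last exact: not_0_IZR.
  by have := PI_RGT_0; lra.
by apply: Rinv_neq_0_compat; lra.
Qed.

Lemma Dhat_neq0 (L : R) (K : nat) (k : mode K) (a : 'I_3) : 0 < L ->
  Dhat L k a <> RtoC 0.
Proof.
move=> L0; rewrite /Dhat; case: Z.eqb_spec => [_|k0].
  by move=> /(f_equal fst) /=; lra.
exact: fourier_symbol_neq0.
Qed.

Lemma mode_oppK (K : nat) : involutive (@mode_opp K).
Proof. by move=> k; apply/ffunP => a; rewrite !ffunE rev_ordK. Qed.

Lemma Z_eqb_opp0 (n : Z) : Z.eqb (- n) 0 = Z.eqb n 0.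
Proof. by case: n. Qed.

Lemma fourier_symbol_opp (L : R) (n : Z) : L <> 0 ->
  fourier_symbol L (- n) = Cconj (fourier_symbol L n).
Proof.
move=> L0; rewrite !fourier_symbolE // opp_IZR.
by apply: injective_projections => /=; field.
Qed.

Lemma Dhat_opp (L : R) (K : nat) (k : mode K) (a : 'I_3) : L <> 0 ->
  Dhat L (mode_opp k) a = Cconj (Dhat L k a).
Proof.
move=> L0; rewrite /Dhat kval_opp Z_eqb_opp0 fourier_symbol_opp //.
by case: Z.eqb => //; rewrite Cconj_RtoC.
Qed.

Lemma Dtilde_opp (K : nat) (k : mode K) (a : 'I_3) :
  Dtilde (mode_opp k) a = Dtilde k a.
Proof. by rewrite /Dtilde kval_opp Z_eqb_opp0. Qed.

(** * Differentiation rules for products with constants, conjugates and sums in C *)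

Lemma is_derive_Cmult (f : R -> C) (c : C) (t : R) (l : C) :
  is_derive (V := C_R_NormedModule) f t l ->
  is_derive (V := C_R_NormedModule) (fun s => c * f s)%C t (c * l)%C.
Proof.
rewrite !is_derive_C_components => -[f1 f2]; split.
  exact: (is_derive_minus _ _ _ _ _ (is_derive_scal _ _ (Re c) _ f1)
    (is_derive_scal _ _ (Im c) _ f2)).
exact: (is_derive_plus _ _ _ _ _ (is_derive_scal _ _ (Re c) _ f2)
    (is_derive_scal _ _ (Im c) _ f1)).
Qed.

Lemma is_derive_Cconj (f : R -> C) (t : R) (l : C) :
  is_derive (V := C_R_NormedModule) f t l ->
  is_derive (V := C_R_NormedModule) (fun s => Cconj (f s)) t (Cconj l).
Proof.
rewrite !is_derive_C_components => -[f1 f2]; split=> //.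
exact: (is_derive_opp _ _ _ f2).
Qed.

Lemma is_derive_Cminus (f g : R -> C) (t : R) (l m : C) :
  is_derive (V := C_R_NormedModule) f t l ->
  is_derive (V := C_R_NormedModule) g t m ->
  is_derive (V := C_R_NormedModule) (fun s => f s - g s)%C t (l - m)%C.
Proof. exact: is_derive_minus. Qed.

Lemma is_derive_Cconst (c : C) (t : R) :
  is_derive (V := C_R_NormedModule) (fun=> c) t (RtoC 0).
Proof. exact: is_derive_const. Qed.

Lemma is_derive_Csum (I : finType) (F : I -> R -> C) (l : I -> C) (t : R) :
  (forall i, is_derive (V := C_R_NormedModule) (F i) t (l i)) ->
  is_derive (V := C_R_NormedModule)
    (fun s => \big[Cplus/RtoC 0]_i F i s) t (\big[Cplus/RtoC 0]_i l i).
Proof.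
move=> H; elim: index_enum => [|i r IH].
  rewrite big_nil; apply: is_derive_ext (is_derive_Cconst (RtoC 0) t) => s.
  by rewrite big_nil.
rewrite big_cons.
apply: is_derive_ext (is_derive_plus (V := C_R_NormedModule) _ _ _ _ _ (H i) IH).
by move=> s; rewrite big_cons.
Qed.

(** * Uniqueness of primitives on an open interval around 0 *)

Lemma eq_of_is_derive (t0 t1 : Rbar) (f g l : R -> R) :
  Rbar_lt t0 0 -> Rbar_lt 0 t1 ->
  (forall t : R, Rbar_lt t0 t -> Rbar_lt t t1 ->
     is_derive f t (l t) /\ is_derive g t (l t)) ->
  f 0 = g 0 ->
  forall t : R, Rbar_lt t0 t -> Rbar_lt t t1 -> f t = g t.
Proof.
move=> t00 t01 fg fg0 t tt0 tt1.
(* The segment from 0 to [t], whatever the sign of [t], stays inside the interval, so the mean value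
   theorem applies to [f - g]. *)
have D (s : R) : Rmin 0 t <= s <= Rmax 0 t ->
    is_derive (fun s => f s - g s) s 0.
  move=> [s0 s1].
  have st0 : Rbar_lt t0 s.
    move: s0 t00 tt0; rewrite /Rmin; case: Rle_dec => _.
      by case: t0 {fg} => //= r; lra.
    by case: t0 {fg} => //= r; lra.
  have st1 : Rbar_lt s t1.
    move: s1 t01 tt1; rewrite /Rmax; case: Rle_dec => _.
      by case: t1 {fg} => //= r; lra.
    by case: t1 {fg} => //= r; lra.
  have [fs gs] := fg s st0 st1.
  have := is_derive_minus _ _ _ _ _ fs gs.
  by rewrite minus_eq_zero.
have [||c [_]] := MVT_gen (fun s => f s - g s) 0 t (fun=> 0).
- by move=> s hs; apply: D; lra.
- move=> s hs; apply/continuity_pt_filterlim.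
  by apply: (ex_derive_continuous (fun s => f s - g s)); exists 0; apply: D.
- by rewrite fg0; lra.
Qed.

Lemma eq_of_is_derive_C (t0 t1 : Rbar) (f g l : R -> C) :
  Rbar_lt t0 0 -> Rbar_lt 0 t1 ->
  (forall t : R, Rbar_lt t0 t -> Rbar_lt t t1 ->
     is_derive (V := C_R_NormedModule) f t (l t) /\
     is_derive (V := C_R_NormedModule) g t (l t)) ->
  f 0 = g 0 ->
  forall t : R, Rbar_lt t0 t -> Rbar_lt t t1 -> f t = g t.
Proof.
move=> t00 t01 fg fg0 t tt0 tt1; apply: injective_projections.
  apply: (eq_of_is_derive t0 t1 (fun s => Re (f s)) (fun s => Re (g s))
    (fun s => Re (l s))) => // [s s0 s1|]; last by rewrite fg0.
  by have := fg s s0 s1; rewrite !is_derive_C_components => -[[? ?] [? ?]].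
apply: (eq_of_is_derive t0 t1 (fun s => Im (f s)) (fun s => Im (g s))
  (fun s => Im (l s))) => // [s s0 s1|]; last by rewrite fg0.
by have := fg s s0 s1; rewrite !is_derive_C_components => -[[? ?] [? ?]].
Qed.

(** * Arithmetic of circular indices *)

Lemma cycE (a : 'I_3) (z : Z) :
  nat_of_ord (cyc a z) = Z.to_nat ((Z.of_nat a + z) mod 3).
Proof.
rewrite /cyc inordK //; apply/ltP.
have := Z.mod_pos_bound (Z.of_nat a + z) 3; lia.
Qed.

Lemma cyc_add (a : 'I_3) (y z : Z) : cyc (cyc a y) z = cyc a (y + z).
Proof.
apply: val_inj; rewrite /= !cycE Z2Nat.id; last first.
  by have := Z.mod_pos_bound (Z.of_nat a + y) 3; lia.
by rewrite Zplus_mod_idemp_l Z.add_assoc.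
Qed.

Lemma cyc_eq (a : 'I_3) (y z : Z) : (y mod 3 = z mod 3)%Z -> cyc a y = cyc a z.
Proof.
by move=> yz; apply: val_inj; rewrite /= !cycE -Zplus_mod_idemp_r yz
  Zplus_mod_idemp_r.
Qed.

Lemma cyc0 (a : 'I_3) : cyc a 0 = a.
Proof.
apply: val_inj; rewrite /= cycE Z.add_0_r Z.mod_small ?Nat2Z.id //.
by have /ltP := ltn_ord a; lia.
Qed.

Lemma cyc_neq (a : 'I_3) (y z : Z) : (y mod 3 <> z mod 3)%Z -> cyc a y <> cyc a z.
Proof.
move=> yz /(f_equal (fun b : 'I_3 => Z.of_nat b)); rewrite !cycE.
rewrite !Z2Nat.id; try by apply Z.mod_pos_bound.
Z.div_mod_to_equations; lia.
Qed.

Lemma cyc_cases (a b : 'I_3) : [\/ b = a, b = cyc a 1 | b = cyc a (-1)].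
Proof.
case: a => [[|[|[|i]]] Hi] //; case: b => [[|[|[|j]]] Hj] //;
  by [apply: Or31; apply: val_inj | apply: Or32; apply: val_inj; rewrite /= cycE
     | apply: Or33; apply: val_inj; rewrite /= cycE].
Qed.

(** * The flow of the kinetic step *)

(* This is the time integral of
   [v * / Dhat L k a * dft (translate (X t) (Dtilde k a G))] along the straight
   line X t = x0 + t v e_a.  Up to the filter, it is tau times [Vhat3] (for G = S)
   or [Vhat2], but without the division by tau, hence also meaningful at 0. *)
Definition drift (L : R) (M : nat) {K : nat} (a : 'I_3) (v : R) (x0 : point)
    (G : point -> C) (k : mode K) (t : R) : C :=
  if Z.eqb (kval k a) 0 then (RtoC (t * v) * dft L M k (translate x0 G))%C
  else (- (/ fourier_symbol L (kval k a) *
    (dft L M k (translate (upd x0 a (x0 a + t * v)) G) -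
     dft L M k (translate x0 G))))%C.

Lemma drift0 (L : R) (M K : nat) (a : 'I_3) (v : R) (x0 : point)
    (G : point -> C) (k : mode K) : drift L M a v x0 G k 0 = RtoC 0.
Proof.
rewrite /drift Rmult_0_l Rplus_0_r upd_id.
by case: Z.eqb; ring.
Qed.

Lemma dft_translate_mean (L : R) (M K : nat) (k : mode K) (G : point -> C)
    (a : 'I_3) (x0 : point) (s : R) :
  0 < L -> (0 < M)%nat -> C1dir L a G -> kval k a = 0%Z ->
  dft L M k (translate (upd x0 a s) G) = dft L M k (translate x0 G).
Proof.
move=> L0 M0 GC ka0.
(* Shifting the mesh variable by [x0 a - s] replaces the particle coordinate [x0 a] by [s]. *)
rewrite -(dft_mean_shift L M K k L0 M0 (translate x0 G) a (x0 a - s)) //.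
- congr dft; apply: functional_extensionality => x.
  rewrite /translate; congr G; apply: functional_extensionality => b.
  by rewrite /upd; case: eqP => [->|] //; ring.
- exact/unif_cont_translate/(C1dir_uc _ _ _ GC).
- move=> x; rewrite translate_upd.
  apply: etrans (C1dir_per _ _ _ GC (fun b => x b - x0 b)).
  by congr (G (upd _ _ _)); ring.
Qed.

(** For [kval k a = 0] the coefficient does not depend on the position and [drift] is linear in
    time. Otherwise the chain rule produces [v], and the sign from [dft_translate_derive] cancels
    the one in [drift]. *)
Lemma drift_derive (L : R) (M K : nat) (a : 'I_3) (v : R) (x0 : point)
    (G : point -> C) (k : mode K) (t : R) :
  0 < L -> (0 < M)%nat -> C1dir L a G ->
  is_derive (V := C_R_NormedModule) (drift L M a v x0 G k) t
    (RtoC v * (/ Dhat L k a *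
       dft L M k (translate (upd x0 a (x0 a + t * v)) (Dtilde k a G))))%C.
Proof.
move=> L0 M0 GC; rewrite /drift /Dhat /Dtilde.
case: Z.eqb_spec => [ka0|kn0].
  rewrite dft_translate_mean //; set c := dft _ _ _ _.
  have D : is_derive (fun s => s * v) t v by auto_derive => //; ring.
  have -> : (RtoC v * (/ RtoC 1 * c) = RtoC v * c)%C by field.
  have := is_derive_scal_l (V := C_R_NormedModule) _ _ _ c D.
  have e s : scal (V := C_R_NormedModule) s c = (RtoC s * c)%C.
    change ((s * c.1, s * c.2) = (RtoC s * c)%C).
    by apply: injective_projections => /=; ring.
  by rewrite e; apply: is_derive_ext => s; rewrite e.
have h1 : is_derive (fun s => x0 a + s * v) t v by auto_derive => //; ring.
have h2 := dft_translate_derive L M K k G a x0 (x0 a + t * v) L0 M0 GC.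
have := is_derive_comp (V := C_R_NormedModule) _ _ _ _ _ h2 h1.
set d := dft L M k (translate _ (pderiv a G)).
set c := dft L M k (translate x0 G).
have -> : scal (V := C_R_NormedModule) v (- d)%C = (RtoC v * - d)%C.
  change ((v * (- d)%C.1, v * (- d)%C.2) = (RtoC v * - d)%C).
  by apply: injective_projections => /=; ring.
move=> /is_derive_Cminus /(_ (is_derive_Cconst c t)).
move=> /(is_derive_Cmult _ (- / fourier_symbol L (kval k a))%C).
rewrite (_ : (- / _ * _ = RtoC v * (/ fourier_symbol L (kval k a) * d))%C).
  have e z : (- / fourier_symbol L (kval k a) * z =
      - (/ fourier_symbol L (kval k a) * z))%C by ring.
  by apply: is_derive_ext => s; apply: e.
by ring.
Qed.

Lemma drift_opp (L : R) (M K : nat) (a : 'I_3) (v : R) (x0 : point)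
    (G : point -> C) (k : mode K) (t : R) :
  0 < L -> (0 < M)%nat -> unif_cont G -> (forall x, Cconj (G x) = G x) ->
  drift L M a v x0 G (mode_opp k) t = Cconj (drift L M a v x0 G k t).
Proof.
move=> L0 M0 GU Greal.
have dftN y : dft L M (mode_opp k) (translate y G) =
    Cconj (dft L M k (translate y G)).
  rewrite -dft_conj //; last exact: unif_cont_translate.
  by congr dft; apply: functional_extensionality => x; rewrite /translate Greal.
rewrite /drift kval_opp Z_eqb_opp0 !dftN.
case: Z.eqb_spec => [_|k0]; first by rewrite Cmult_conj Cconj_RtoC.
rewrite fourier_symbol_opp; last lra.
rewrite Copp_conj Cmult_conj Cminus_conj Cinv_conj //.
exact: fourier_symbol_neq0.
Qed.

(** Proof irrelevance identifies the Hermitian symmetry proofs stored in the records. *)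
Lemma state_ext (N K : nat) (U W : state N K) :
  X U = X W -> V U = V W -> E U = E W -> B U = B W -> U = W.
Proof.
case: U => x v e b he hb; case: W => x' v' e' b' he' hb' /= xx vv ee bb.
subst; congr State; exact: proof_irrelevance.
Qed.

(** * The explicit candidate solution and its time derivatives *)

Section KineticStep.

Variables (L : R) (K M N : nat) (q m : 'I_N -> R) (gam : mode K -> C).
Variables (S : point -> R) (a : 'I_3) (U0 : state N K).
Hypotheses (L_gt0 : 0 < L) (M_gt0 : (0 < M)%nat) (gam_hermitian : hermitian gam).
Hypothesis (S_C1 : C1per L (fun x => RtoC (S x))).

Let shape (x : point) : C := RtoC (S x).

Lemma Cconj_Dtilde_shape (k : mode K) (b : 'I_3) (x : point) :
  Cconj (Dtilde k b shape x) = Dtilde k b shape x.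
Proof.
rewrite /Dtilde; case: Z.eqb; first exact: Cconj_RtoC.
apply: injective_projections => //=.
by rewrite Derive_const Ropp_0.
Qed.

Lemma shape_C1dir (b : 'I_3) : C1dir L b shape.
Proof. exact: (C1per_C1dir _ _ [::]). Qed.

Lemma Dtilde_shape_C1dir (k : mode K) (b c : 'I_3) : c <> b ->
  C1dir L b (Dtilde k c shape).
Proof.
move=> cb; rewrite /Dtilde; case: Z.eqb; first exact: shape_C1dir.
apply: (C1per_C1dir L shape [:: c]) => //=.
by rewrite inE andbT eq_sym; apply/eqP.
Qed.

Definition flow_position (t : R) (p : 'I_N) : point :=
  upd (X U0 p) a (X U0 p a + t * V U0 p a).

(* The coefficients of the sum are Hermitian, so that this complex number is in
   fact real (see [flow_velocity_real]). *)
Definition flow_velocity (nu : Z) (t : R) (p : 'I_N) : C :=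
  (RtoC (V U0 p (cyc a nu)) - RtoC (IZR nu * (q p / m p) * L ^ 3) *
   \big[Cplus/RtoC 0]_(k : mode K)
     (B U0 (cyc a (- nu)) k *
      Cconj (gam k * / Dhat L k (cyc a nu) *
        drift L M a (V U0 p a) (X U0 p) (Dtilde k (cyc a nu) shape) k t)))%C.

Definition flow_field (t : R) (k : mode K) : C :=
  (E U0 a k - \big[Cplus/RtoC 0]_(p < N)
     (RtoC (q p) * (gam k * drift L M a (V U0 p a) (X U0 p) shape k t)))%C.

Lemma cyc_unit_neq (nu : Z) : nu = 1%Z \/ nu = (-1)%Z -> cyc a nu <> a.
Proof.
by move=> nuP; rewrite -[X in _ <> X]cyc0; apply: cyc_neq; case: nuP => ->.
Qed.

Lemma flow_field_derive (t : R) (k : mode K) :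
  is_derive (V := C_R_NormedModule) (fun s => flow_field s k) t
    (- \big[Cplus/RtoC 0]_(p < N)
       (RtoC (q p) * RtoC (V U0 p a) *
        Pi2 L M gam a (translate (flow_position t p) shape) k))%C.
Proof.
rewrite (_ : (- _ = RtoC 0 - \big[Cplus/RtoC 0]_(p < N) (RtoC (q p) * (gam k *
  (RtoC (V U0 p a) * (/ Dhat L k a *
   dft L M k (translate (flow_position t p) (Dtilde k a shape)))))))%C).
  apply: is_derive_Cminus (is_derive_Cconst _ _) _; apply: is_derive_Csum => p.
  by do 2 apply: is_derive_Cmult; apply: drift_derive => //; apply: shape_C1dir.
rewrite /Cminus Cplus_0_l; congr Copp; apply: eq_bigr => p _.
by rewrite /Pi2 Dtilde_translate; ring.
Qed.

(** The two directions complementary to a - nu are a and a + nu. Putting the derivative along [a]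
    outermost gives the form met in [drift_derive], with [Dtilde k (cyc a nu) shape] as the
    transported function. For nu = -1 the circular order is the opposite one, and the derivatives
    are swapped by [pderiv_comm]. *)
Lemma Pi1_transverse (nu : Z) (y : point) (k : mode K) :
  nu = 1%Z \/ nu = (-1)%Z ->
  Pi1 L M gam (cyc a (- nu)) (translate y shape) k =
  (gam k * / Dhat L k (cyc a nu) * (/ Dhat L k a *
    dft L M k (translate y (Dtilde k a (Dtilde k (cyc a nu) shape)))))%C.
Proof.
move=> nuP; have ab := cyc_unit_neq _ nuP.
have D0 b := Dhat_neq0 L K k b L_gt0.
rewrite /Pi1 !cyc_add !Dtilde_translate.
case: nuP ab => -> ab.
  rewrite (cyc_eq a (- 1 + 1) 0) // (cyc_eq a (- 1 + 2) 1) // cyc0.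
  by field; split; apply: D0.
rewrite (cyc_eq a (- -1 + 1) (-1)) // (cyc_eq a (- -1 + 2) 0) // cyc0.
have -> : Dtilde k (cyc a (-1)) (Dtilde k a shape) =
    Dtilde k a (Dtilde k (cyc a (-1)) shape).
  rewrite /Dtilde; case: Z.eqb; case: Z.eqb => //.
  exact: (pderiv_comm L).
by field; split; apply: D0.
Qed.

Lemma flow_velocity_derive (nu : Z) (t : R) (p : 'I_N) :
  nu = 1%Z \/ nu = (-1)%Z ->
  is_derive (V := C_R_NormedModule) (fun s => flow_velocity nu s p) t
    (RtoC (- IZR nu * (q p / m p) * L ^ 3) *
     \big[Cplus/RtoC 0]_(k : mode K)
       (RtoC (V U0 p a) * B U0 (cyc a (- nu)) k *
        Cconj (Pi1 L M gam (cyc a (- nu))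
                 (translate (flow_position t p) shape) k)))%C.
Proof.
move=> nuP; have ab := cyc_unit_neq _ nuP.
have -> : - IZR nu * (q p / m p) * L ^ 3 = - (IZR nu * (q p / m p) * L ^ 3).
  by ring.
set c := IZR nu * _ * _.
pose F k := (B U0 (cyc a (- nu)) k *
    Cconj (gam k * / Dhat L k (cyc a nu) * (RtoC (V U0 p a) * (/ Dhat L k a *
      dft L M k (translate (flow_position t p)
        (Dtilde k a (Dtilde k (cyc a nu) shape)))))))%C.
rewrite (_ : (RtoC (- c) * _ =
    RtoC 0 - RtoC c * \big[Cplus/RtoC 0]_(k : mode K) F k)%C).
  apply: is_derive_Cminus (is_derive_Cconst _ _) _; apply: is_derive_Cmult.
  apply: is_derive_Csum => k; apply: is_derive_Cmult; apply: is_derive_Cconj.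
  apply: is_derive_Cmult; apply: drift_derive => //.
  exact: Dtilde_shape_C1dir.
transitivity (RtoC (- c) * \big[Cplus/RtoC 0]_(k : mode K) F k)%C; last first.
  by rewrite RtoC_opp; ring.
congr Cmult; apply: eq_bigr => k _; rewrite (Pi1_transverse _ _ _ nuP).
rewrite (Cmult_comm (RtoC _)) -Cmult_assoc; congr Cmult.
(* The velocity along [a] is real, so it may enter the conjugate. *)
by rewrite -{1}(Cconj_RtoC (V U0 p a)) -Cmult_conj; congr Cconj; ring.
Qed.

Lemma flow_velocity_real (nu : Z) (t : R) (p : 'I_N) :
  nu = 1%Z \/ nu = (-1)%Z ->
  RtoC (Re (flow_velocity nu t p)) = flow_velocity nu t p.
Proof.
move=> nuP; have ab := cyc_unit_neq _ nuP.
suff h : Cconj (flow_velocity nu t p) = flow_velocity nu t p.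
  apply: injective_projections => //=.
  by have := f_equal Im h; rewrite /Im /=; lra.
rewrite /flow_velocity Cminus_conj Cmult_conj !Cconj_RtoC; congr Cminus.
congr Cmult; rewrite (big_morph Cconj Cplus_conj (Cconj_RtoC 0)).
(* After exchanging k and -k, each conjugated summand matches by Hermitian symmetry of its
   factors. *)
rewrite [RHS](reindex_inj (inv_inj (mode_oppK K))); apply: eq_bigr => k _.
rewrite Cmult_conj Cconj_conj; congr Cmult.
  by rewrite {1}(B_hermitian U0) Cconj_conj.
rewrite Dtilde_opp Dhat_opp; last lra.
rewrite drift_opp //; last 2 first.
- exact: C1dir_uc (Dtilde_shape_C1dir _ _ _ ab).
- exact: Cconj_Dtilde_shape.
rewrite {1}gam_hermitian -Cinv_conj; last exact: Dhat_neq0.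
by rewrite !Cmult_conj !Cconj_conj.
Qed.

Lemma flow_field_hermitian (t : R) : hermitian (flow_field t).
Proof.
move=> k; rewrite /flow_field Cminus_conj -(E_hermitian U0); congr Cminus.
rewrite (big_morph Cconj Cplus_conj (Cconj_RtoC 0)); apply: eq_bigr => p _.
rewrite drift_opp //; last 2 first.
- exact: C1dir_uc (shape_C1dir a).
- by move=> x; apply: Cconj_RtoC.
by rewrite !Cmult_conj Cconj_conj Cconj_RtoC -gam_hermitian.
Qed.

(** Links the averaged form of the claim, which divides by [tau], to the primitive used in the
    flow. *)
Lemma tau_Vhat3 (tau : R) (p : 'I_N) (k : mode K) : tau <> 0 ->
  (RtoC tau * Vhat3 L M gam shape a tau (V U0 p a) (X U0 p)
     (flow_position tau p) k)%C =
  (gam k * drift L M a (V U0 p a) (X U0 p) shape k tau)%C.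
Proof.
move=> tau0; have tau1 : RtoC tau <> RtoC 0 by move=> /(f_equal fst).
rewrite /Vhat3 /drift /Pi3 -/(flow_position tau p).
case: Z.eqb_spec => [_|k0]; first by rewrite RtoC_mult; ring.
by rewrite RtoC_inv //; field; split => //; apply: fourier_symbol_neq0.
Qed.

Lemma tau_Vhat2 (nu : Z) (tau : R) (p : 'I_N) (k : mode K) : tau <> 0 ->
  (RtoC tau * Vhat2 L M gam shape a nu tau (V U0 p a) (X U0 p)
     (flow_position tau p) k)%C =
  (gam k * / Dhat L k (cyc a nu) *
   drift L M a (V U0 p a) (X U0 p) (Dtilde k (cyc a nu) shape) k tau)%C.
Proof.
move=> tau0; have tau1 : RtoC tau <> RtoC 0 by move=> /(f_equal fst).
have D0 b := Dhat_neq0 L K k b L_gt0.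
rewrite /Vhat2 /drift /Pi2 !Dtilde_translate -/(flow_position tau p).
case: Z.eqb_spec => [_|k0]; first by rewrite RtoC_mult; ring.
by rewrite RtoC_inv //; field; do !split => //; apply: fourier_symbol_neq0.
Qed.

Definition flow_E (t : R) (b : 'I_3) : mode K -> C :=
  if b == a then flow_field t else E U0 b.

Lemma flow_E_hermitian (t : R) (b : 'I_3) : hermitian (flow_E t b).
Proof.
rewrite /flow_E; case: eqP => _; last exact: E_hermitian.
exact: flow_field_hermitian.
Qed.

(** Real parts make the velocities real by construction; [flow_V_transverse] shows that nothing is
    lost. The last branch is direction a - 1. *)
Definition flow_V (t : R) (p : 'I_N) : point := fun b =>
  if b == a then V U0 p b
  else if b == cyc a 1 then Re (flow_velocity 1 t p)
  else Re (flow_velocity (-1) t p).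

Definition flow (t : R) : state N K :=
  State (flow_position t) (flow_V t) (flow_E_hermitian t)
    (B_hermitian U0).

Lemma flow_velocity0 (nu : Z) (p : 'I_N) :
  flow_velocity nu 0 p = RtoC (V U0 p (cyc a nu)).
Proof.
rewrite /flow_velocity big1 ?Cmult_0_r /Cminus ?Copp_0 ?Cplus_0_r // => k _.
by rewrite drift0 Cmult_0_r Cconj_RtoC Cmult_0_r.
Qed.

Lemma flow_field0 (k : mode K) : flow_field 0 k = E U0 a k.
Proof.
rewrite /flow_field big1 ?Copp_0 /Cminus ?Copp_0 ?Cplus_0_r // => p _.
by rewrite drift0 !Cmult_0_r.
Qed.

Lemma flow_init : flow 0 = U0.
Proof.
apply: state_ext => /=; apply: functional_extensionality => p.
- by rewrite /flow_position Rmult_0_l Rplus_0_r upd_id.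
- apply: functional_extensionality => b; rewrite /flow_V.
  case: eqP => // ba; case: eqP => [->|b1]; first by rewrite flow_velocity0.
  rewrite flow_velocity0; congr (V U0 p _).
  by case: (cyc_cases a b).
- apply: functional_extensionality => k; rewrite /flow_E.
  by case: eqP => // ->; rewrite flow_field0.
- by [].
Qed.

Lemma flow_V_transverse (nu : Z) (t : R) (p : 'I_N) :
  nu = 1%Z \/ nu = (-1)%Z ->
  RtoC (flow_V t p (cyc a nu)) =
  flow_velocity nu t p.
Proof.
move=> nuP; have ab := cyc_unit_neq nu nuP.
rewrite -(flow_velocity_real) // /flow_V.
have /eqP/negbTE -> := ab.
case: nuP ab => -> _; first by rewrite eqxx.
have /eqP/negbTE -> // : cyc a (-1) <> cyc a 1 by apply: cyc_neq.
Qed.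

(** * Existence and uniqueness for the kinetic step *)

Lemma flow_solution :
  kinetic_solution L M q m gam shape a m_infty p_infty flow.
Proof.
have Va t p : V (flow t) p a = V U0 p a by rewrite /= /flow_V eqxx.
move=> t _ _; split; last split; last split.
- move=> p; split.
    rewrite Va /= /flow_position.
    apply: (is_derive_ext (fun s => X U0 p a + s * V U0 p a)).
      by move=> s; rewrite upd_same.
    by auto_derive => //; ring.
  apply: (is_derive_ext (fun _ => V U0 p a)); first by move=> s; rewrite Va.
  exact: is_derive_const.
- move=> k.
  apply: (is_derive_ext (V := C_R_NormedModule)
    (fun s => flow_field s k)).
    by move=> s; rewrite /= /flow_E eqxx.
  rewrite (eq_bigr (fun p => RtoC (q p) * RtoC (V U0 p a) * Pi2 L M gam a
    (translate (flow_position t p) shape) k)%C).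
    exact: flow_field_derive.
  by move=> p _; rewrite Va.
- move=> nu nuP; have ab := cyc_unit_neq nu nuP; split=> [p|k]; first split.
  + apply: (is_derive_ext (fun _ => X U0 p (cyc a nu))).
      by move=> s; rewrite /= /flow_position upd_other.
    exact: is_derive_const.
  + apply: (is_derive_ext (V := C_R_NormedModule)
      (fun s => flow_velocity nu s p)).
      by move=> s; rewrite -flow_V_transverse.
    rewrite Va.
    exact: flow_velocity_derive.
  + apply: (is_derive_ext (V := C_R_NormedModule) (fun _ => E U0 (cyc a nu) k)).
      by move=> s; rewrite /= /flow_E; have /eqP/negbTE -> := ab.
    exact: is_derive_Cconst.
- move=> b k; exact: is_derive_Cconst.
Qed.

(** The system is triangular: V_a comes first, then X, B and E, then the transverse velocities. At
    each stage both sides have the same known derivative, so uniqueness of primitives suffices. *)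
Lemma solution_eq_flow (t0 t1 : Rbar) (U : R -> state N K) :
  Rbar_lt t0 0 -> Rbar_lt 0 t1 ->
  kinetic_solution L M q m gam shape a t0 t1 U -> U 0 = U0 ->
  forall t : R, Rbar_lt t0 t -> Rbar_lt t t1 -> U t = flow t.
Proof.
move=> t00 t01 Usol Uinit.
have Fsol (t : R) (h0 : Rbar_lt t0 t) (h1 : Rbar_lt t t1) := flow_solution t I I.
have Finit := flow_init.
have eqR := fun f g l => eq_of_is_derive t0 t1 f g l t00 t01.
have eqC := fun f g l => eq_of_is_derive_C t0 t1 f g l t00 t01.
have bcases (P : 'I_3 -> Prop) : P a ->
    (forall nu, nu = 1%Z \/ nu = (-1)%Z -> P (cyc a nu)) -> forall b, P b.
  move=> Pa Pnu b; case: (cyc_cases a b) => -> //; apply: Pnu; by [left | right].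
have EVa (t : R) : Rbar_lt t0 t -> Rbar_lt t t1 -> forall p,
    V (U t) p a = V (flow t) p a.
  move=> h0 h1 p.
  apply: (eqR (fun s => V (U s) p a) (fun s => V (flow s) p a)
      (fun=> 0) _ _ t h0 h1)
      => [s s0 s1|]; last by rewrite Uinit Finit.
  by split; [case: (Usol s s0 s1) | case: (Fsol s s0 s1)] => /(_ p) [].
have EX (t : R) : Rbar_lt t0 t -> Rbar_lt t t1 -> X (U t) = X (flow t).
  move=> h0 h1; apply: functional_extensionality => p.
  apply: functional_extensionality; apply: bcases => [|nu nuP].
    apply: (eqR (fun s => X (U s) p a) (fun s => X (flow s) p a)
      (fun s => V (flow s) p a) _ _ t h0 h1)
      => [s s0 s1|]; last by rewrite Uinit Finit.
    split; last by case: (Fsol s s0 s1) => /(_ p) [].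
    by rewrite -EVa //; case: (Usol s s0 s1) => /(_ p) [].
  apply: (eqR (fun s => X (U s) p (cyc a nu)) (fun s => X (flow s) p (cyc a nu))
    (fun=> 0) _ _ t h0 h1)
      => [s s0 s1|]; last by rewrite Uinit Finit.
  by split; [case: (Usol s s0 s1) | case: (Fsol s s0 s1)]
    => _ [_ [/(_ nu nuP) [/(_ p) [? _] _] _]].
have EB (t : R) : Rbar_lt t0 t -> Rbar_lt t t1 -> B (U t) = B (flow t).
  move=> h0 h1; apply: functional_extensionality => b.
  apply: functional_extensionality => k.
  apply: (eqC (fun s => B (U s) b k) (fun s => B (flow s) b k)
    (fun=> RtoC 0) _ _ t h0 h1)
      => [s s0 s1|]; last by rewrite Uinit Finit.
  by split; [case: (Usol s s0 s1) | case: (Fsol s s0 s1)] => _ [_ [_ /(_ b k)]].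
have EE (t : R) : Rbar_lt t0 t -> Rbar_lt t t1 -> E (U t) = E (flow t).
  move=> h0 h1; apply: functional_extensionality => b.
  apply: functional_extensionality => k; move: b; apply: bcases => [|nu nuP].
    apply: (eqC (fun s => E (U s) a k) (fun s => E (flow s) a k)
      (fun s => (- \big[Cplus/RtoC 0]_(p < N)
            (RtoC (q p) * RtoC (V (flow s) p a) *
             Pi2 L M gam a (translate (X (flow s) p) shape) k))%C) _ _ t h0 h1)
      => [s s0 s1|]; last by rewrite Uinit Finit.
    split; last by case: (Fsol s s0 s1) => _ [/(_ k)].
    (* With positions and V_a already identified, the source in the equation of [U] becomes that of
       the flow. *)
    have [_ [/(_ k) H _]] := Usol s s0 s1; rewrite EX // in H.
    rewrite (eq_bigr (fun p => RtoC (q p) * RtoC (V (U s) p a) *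
      Pi2 L M gam a (translate (X (flow s) p) shape) k)%C) //.
    by move=> p _; rewrite EVa.
  apply: (eqC (fun s => E (U s) (cyc a nu) k) (fun s => E (flow s) (cyc a nu) k)
    (fun=> RtoC 0) _ _ t h0 h1)
      => [s s0 s1|]; last by rewrite Uinit Finit.
  by split; [case: (Usol s s0 s1) | case: (Fsol s s0 s1)]
    => _ [_ [/(_ nu nuP) [_ /(_ k)]]].
move=> t h0 h1; apply: state_ext; rewrite ?EX ?EE ?EB //.
apply: functional_extensionality => p; apply: functional_extensionality.
apply: bcases => [|nu nuP]; first exact: EVa.
(* The transverse velocity equations are stated in C, so the comparison is made there. *)
apply: RtoC_inj.
apply: (eqC (fun s => RtoC (V (U s) p (cyc a nu)))
  (fun s => RtoC (V (flow s) p (cyc a nu)))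
  (fun s => RtoC (- IZR nu * (q p / m p) * L ^ 3) *
           \big[Cplus/RtoC 0]_(k : mode K)
             (RtoC (V (flow s) p a) * B (flow s) (cyc a (- nu)) k *
              Cconj (Pi1 L M gam (cyc a (- nu))
                (translate (X (flow s) p) shape) k)))%C _ _ t h0 h1)
      => [s s0 s1|]; last by rewrite Uinit Finit.
split; last by case: (Fsol s s0 s1) => _ [_ [/(_ nu nuP) [/(_ p) []]]].
have [_ [_ [/(_ nu nuP) [/(_ p) [_ H] _] _]]] := Usol s s0 s1.
by rewrite EX // EVa // EB // in H.
Qed.

End KineticStep.

Theorem lemma4 (L : R) (K M N : nat) (q m : 'I_N -> R) (gam : mode K -> C)
    (S : point -> R) (alpha : 'I_3) (U0 : state N K)
    (L_gt0 : 0 < L) (M_ge : (2 * K + 1 <= M)%nat) (N_ge1 : (1 <= N)%nat)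
    (m_gt0 : forall p, 0 < m p) (gam_hermitian : hermitian gam)
    (S_C1 : C1per L (fun x => RtoC (S x))) :
  let shape : point -> C := fun x => RtoC (S x) in
  (exists U : R -> state N K,
     kinetic_solution L M q m gam shape alpha m_infty p_infty U /\
     U 0 = U0) /\
  (forall (t0 t1 : Rbar) (U : R -> state N K),
     Rbar_lt t0 0 -> Rbar_lt 0 t1 ->
     kinetic_solution L M q m gam shape alpha t0 t1 U -> U 0 = U0 ->
     forall tau : R, tau <> 0 -> Rbar_lt t0 tau -> Rbar_lt tau t1 ->
     forall (p : 'I_N) (k : mode K) (nu : Z), nu = 1%Z \/ nu = (-1)%Z ->
       X (U tau) p alpha = X U0 p alpha + tau * V U0 p alpha /\
       X (U tau) p (cyc alpha nu) = X U0 p (cyc alpha nu) /\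
       V (U tau) p alpha = V U0 p alpha /\
       RtoC (V (U tau) p (cyc alpha nu)) =
         (RtoC (V U0 p (cyc alpha nu)) -
          RtoC (IZR nu * tau * (q p / m p) * L ^ 3) *
          \big[Cplus/RtoC 0]_(k' : mode K)
            (B U0 (cyc alpha (- nu)) k' *
             Cconj (Vhat2 L M gam shape alpha nu tau (V U0 p alpha)
                      (X U0 p) (X (U tau) p) k')))%C /\
       E (U tau) alpha k =
         (E U0 alpha k -
          RtoC tau *
          \big[Cplus/RtoC 0]_(p' < N)
            (RtoC (q p') *
             Vhat3 L M gam shape alpha tau (V U0 p' alpha)
               (X U0 p') (X (U tau) p') k))%C /\
       E (U tau) (cyc alpha nu) k = E U0 (cyc alpha nu) k /\
       (forall b : 'I_3, B (U tau) b k = B U0 b k)).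
Proof.
move=> shape.
have M_gt0 : (0 < M)%nat by apply: leq_trans M_ge; rewrite addn1.
pose F := flow L K M N q m gam S alpha U0 L_gt0 M_gt0 gam_hermitian S_C1.
split.
  exists F; split; [exact: flow_solution | exact: flow_init].
move=> t0 t1 U t00 t01 Usol Uinit tau tau0 taut0 taut1 p k nu nuP.
(* By uniqueness the formulas can be read off the explicit flow. *)
have -> : U tau = F tau.
  by apply: (solution_eq_flow _ _ _ _ _ _ _ _ _ _ _ _ _ _ t0 t1).
have ab := cyc_unit_neq alpha nu nuP.
split; first by rewrite /= /flow_position upd_same.
split; first by rewrite /= /flow_position upd_other.
split; first by rewrite /= /flow_V eqxx.
split.
  rewrite [LHS]flow_V_transverse // /flow_velocity; congr Cminus.
  have -> : RtoC (IZR nu * tau * (q p / m p) * L ^ 3) =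
      (RtoC (IZR nu * (q p / m p) * L ^ 3) * RtoC tau)%C.
    by rewrite -RtoC_mult; congr RtoC; ring.
  rewrite -Cmult_assoc; congr Cmult.
  (* The factor [tau] is moved into the sum, where it turns each [Vhat2] into the corresponding
     [drift] term. *)
  rewrite (big_morph (Cmult (RtoC tau)) (Cmult_plus_distr_l _) (Cmult_0_r _)).
  apply: eq_bigr => k' _; rewrite -tau_Vhat2 // Cmult_conj Cconj_RtoC.
  by rewrite !Cmult_assoc (Cmult_comm (B _ _ _)).
split.
  rewrite /= /flow_E eqxx /flow_field; congr Cminus.
  rewrite (big_morph (Cmult (RtoC tau)) (Cmult_plus_distr_l _) (Cmult_0_r _)).
  apply: eq_bigr => p' _; rewrite -tau_Vhat3 //.
  by rewrite !Cmult_assoc (Cmult_comm (RtoC tau)).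
split=> //.
by rewrite /= /flow_E; have /eqP/negbTE -> := ab.
Qed.
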